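(* Let $\mathcal I$ be a Banach Lipschitz operator ideal. Then $\mathcal I$ is maximal if and only if $\mathcal I$ is regular and ultrastable.
   Context: Banach spaces are real; $\mathcal L(E,F)$ is the space of bounded linear operators, $J_E\colon E\to E''$ the canonical inclusion. A pointed metric space has a distinguished point $0$ (for a Banach space, its origin). $\mathrm{Lip}_0(X,Y)$ is the set of Lipschitz maps $f\colon X\to Y$ with $f(0)=0$, and $\mathrm{Lip}(f)$ is the least Lipschitz constant. A Banach Lipschitz operator ideal $\mathcal I$ assigns to each pointed metric space $X$ and Banach space $E$ a linear subspace $\mathcal I(X,E)\subset \mathrm{Lip}_0(X,E)$ with a norm $\|\cdot\|_{\mathcal I}$ such that: $(\mathcal I(X,E),\|\cdot\|_{\mathcal I})$ is a Banach space and $\mathrm{Lip}(f)\le\|f\|_{\mathcal I}$; $Id_{\mathbb R}\in\mathcal I(\mathbb R,\mathbb R)$ with norm $1$; if $g\in\mathrm{Lip}_0(Y,X)$, $f\in\mathcal I(X,E)$, $S\in\mathcal L(E,F)$, then $S\circ f\circ g\in\mathcal I(Y,F)$ and $\|S\circ f\circ g\|_{\mathcal I}\le \|S\|\,\|f\|_{\mathcal I}\,\mathrm{Lip}(g)$. Equality of two such ideals means equal components and equal norms. Maximal hull $\mathcal I^{\max}$: $f\in\mathrm{Lip}_0(X,E)$ belongs to $\mathcal I^{\max}(X,E)$ iff $\|f\|_{\mathcal I^{\max}}:=\sup\|q_L^E\circ f\circ\iota_{X_0}^X\|_{\mathcal I}<\infty$, the supremum being over all finite subsets $X_0\subset X$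 containing $0$ (with inclusion $\iota_{X_0}^X\colon X_0\to X$) and all finite-codimensional closed subspaces $L\subset E$ (with quotient map $q_L^E\colon E\to E/L$). $\mathcal I$ is maximal if $\mathcal I=\mathcal I^{\max}$. Regular hull $\mathcal I^{\mathrm{reg}}$: $f\in\mathcal I^{\mathrm{reg}}(X,E)$ iff $J_E\circ f\in\mathcal I(X,E'')$, with $\|f\|_{\mathcal I^{\mathrm{reg}}}=\|J_E\circ f\|_{\mathcal I}$. $\mathcal I$ is regular if $\mathcal I=\mathcal I^{\mathrm{reg}}$. Ultraproducts: for an ultrafilter $\mathcal U$ on $I$ and Banach spaces $(E_i)_{i\in I}$, $(E_i)_{\mathcal U}$ is the Banach space ultraproduct. For pointed metric spaces $(X_i)_{i\in I}$, $(X_i)_{\mathcal U}$ is the ultralimit: classes $(x_i)_{\mathcal U}$ of families with $\sup_i d(x_i,0_i)<\infty$, distance $\lim_{\mathcal U}d(x_i,y_i)$ (families at distance $0$ identified), base point $(0_i)_{\mathcal U}$. If $f_i\in \mathrm{Lip}_0(X_i,E_i)$ have uniformly bounded Lipschitz constants, $(f_i)^{\mathcal U}\colon (X_i)_{\mathcal U}\to(E_i)_{\mathcal U}$ is $(x_i)_{\mathcal U}\mapsto (f_i(x_i))_{\mathcal U}$. $\mathcal I$ is ultrastable if for all families $(X_i)_{i\in I}$ of pointed metric spaces, $(E_i)_{i\in I}$ of Banach spaces, $f_i\in\mathcal I(X_i,E_i)$ with $\sup_i\|f_i\|_{\mathcal I}<\infty$, and every ultrafilter $\mathcal U$ on $I$,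 one has $(f_i)^{\mathcal U}\in\mathcal I((X_i)_{\mathcal U},(E_i)_{\mathcal U})$ and $\|(f_i)^{\mathcal U}\|_{\mathcal I}\le\lim_{\mathcal U}\|f_i\|_{\mathcal I}$. *)

(* Defs.v *)
From HB Require Import structures.
From mathcomp Require Import all_boot all_order all_algebra.
From mathcomp Require Import generic_quotient ring_quotient ring lra.
From mathcomp Require Import all_classical all_reals.
From mathcomp Require Import ereal topology normedtype sequences.

Set Implicit Arguments.
Unset Strict Implicit.
Unset Printing Implicit Defensive.

Import Order.TTheory GRing.Theory Num.Theory.
Import numFieldNormedType.Exports.

Local Open Scope classical_set_scope.
Local Open Scope ring_scope.

Section geometric_series.
Variable R : realType.
Local Notation h := (2^-1 : R).

Lemma h_gt0 : 0 < h. Proof. by rewrite invr_gt0. Qed.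
Lemma hX_gt0 n : 0 < h ^+ n. Proof. by rewrite exprn_gt0// h_gt0. Qed.
Lemma hXS n : h ^+ n = 2 * h ^+ n.+1.
Proof. by rewrite exprS mulrA divff ?mul1r ?pnatr_eq0. Qed.

Lemma hX_cvg0 : (h ^+ n @[n --> \oo] --> (0 : R)).
Proof.
by apply: cvg_expr; rewrite ger0_norm ?invf_lt1 ?ltr1n//.
Qed.

Lemma hX_le (e : R) : 0 < e -> exists n, h ^+ n < e.
Proof.
move=> e0; have /cvgrPdist_lt/(_ _ e0)[N _ hN] := hX_cvg0.
exists N; have := hN N (leqnn N).
by rewrite /= sub0r normrN ger0_norm// ltW ?hX_gt0.
Qed.

Lemma geometric_partial (E : normedModType R) (A : R) (x : nat -> E) n m :
  (forall n, `|x n| <= A * h ^+ n) ->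
  `|\sum_(k < n + m) x k - \sum_(k < n) x k|
    <= 2 * A * (h ^+ n - h ^+ (n + m)).
Proof.
move=> xA; elim: m => [|m IH]; first by rewrite addn0 !subrr normr0 mulr0.
rewrite addnS big_ord_recr/= addrAC (le_trans (ler_normD _ _))//.
have := lerD IH (xA (n + m)%N); move/le_trans; apply.
by rewrite (hXS (n + m)%N); lra.
Qed.

Lemma geometric_sum (E : completeNormedModType R) (A : R) (x : nat -> E) :
  (forall n, `|x n| <= A * h ^+ n) ->
  exists s, forall n, `|s - \sum_(k < n) x k| <= 2 * A * h ^+ n.
Proof.
move=> xA; pose u n := \sum_(k < n) x k.
have A0 : 0 <= A by have := xA 0%N; rewrite expr0 mulr1; apply: le_trans.
have bnd n m : `|u (n + m)%N - u n| <= 2 * A * h ^+ n.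
  rewrite (le_trans (geometric_partial n m xA))// ler_wpM2l ?mulr_ge0//.
  by rewrite gerBl ltW ?hX_gt0.
have /cauchy_cvgP/cvg_ex[s us] : cauchy (u @ \oo).
  apply/cauchy_exP => e e0.
  have [n hn] : exists n, h ^+ n < e / (2 * A + 1).
    by apply: hX_le; rewrite divr_gt0// ltr_wpDl ?mulr_ge0.
  exists (u n); exists n => // m /= nm; rewrite -ball_normE /= distrC.
  rewrite -(subnKC nm) (le_lt_trans (bnd _ _))//.
  move: hn; rewrite ltr_pdivlMr ?ltr_wpDl ?mulr_ge0// mulrC.
  by apply: le_lt_trans; rewrite ler_wpM2r ?lerDl// ltW ?hX_gt0.
exists s => n.
have : `|u m - u n| @[m --> \oo] --> `|s - u n|.
  by apply: cvg_norm; apply: cvgB => //; exact: cvg_cst.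
move=> /(@closed_cvg _ _ \oo _ _ [set y : R | y <= 2 * A * h ^+ n]); apply.
  exact: closed_le.
by exists n => // m /= nm; rewrite -(subnKC nm).
Qed.

Lemma geometric_complete (V : normedModType R) :
  (forall x : nat -> V, (forall n, `|x n| <= h ^+ n) ->
     exists C s, forall n, `|s - \sum_(k < n) x k| <= C * h ^+ n) ->
  forall F : set_system V, ProperFilter F -> cauchy F -> cvg F.
Proof.
move=> geo F FF /cauchyP Fc.
have /choice[a aF] : forall n, exists y, F (ball y (h ^+ n.+2)).
  by move=> n; apply: Fc; exact: hX_gt0.
have aD n : `|a n.+1 - a n| <= h ^+ n.
  have [z []] := filter_ex (filterI (aF n) (aF n.+1)).
  rewrite -!ball_normE /= => az a1z.
  rewrite (le_trans (ler_distD z _ _))// distrC [X in _ + X]distrC distrC.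
  rewrite (le_trans (lerD (ltW a1z) (ltW az)))//.
  have := hX_gt0 n.+3; rewrite (hXS n) (hXS n.+1) (hXS n.+2); lra.
have [C [s sP]] := geo _ aD.
have sa n : `|s + a 0%N - a n| <= C * h ^+ n.
  have := sP n; rewrite -[X in s - X](big_mkord xpredT (fun k => a k.+1 - a k)).
  by rewrite telescope_sumr// opprB addrA.
have C0 : 0 <= C by have := sP 0%N; rewrite expr0 mulr1; apply: le_trans.
apply/cvg_ex; exists (s + a 0%N); apply/cvgrPdist_lt => e e0.
have [n hn] : exists n, h ^+ n < e / (C + 1).
  by apply: hX_le; rewrite divr_gt0// ltr_wpDl.
have := aF n; apply: filterS => y; rewrite -ball_normE /= => any.
rewrite (le_lt_trans (ler_distD (a n) _ _))//.
rewrite (le_lt_trans (lerD (sa n) (ltW any)))//.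
move: hn; rewrite ltr_pdivlMr ?ltr_wpDl// mulrDr mulr1 mulrC.
have := hX_gt0 n.+2; rewrite (hXS n) (hXS n.+1); lra.
Qed.

End geometric_series.

Record pmetricType (R : realType) := PMetric {
  pm_metric :> metricType R ;
  pm_base : pm_metric }.

Arguments PMetric {R}.
Arguments pm_base {R}.

Section lipschitz.
Variables (R : realType) (X Y : pmetricType R).

Definition lip_bound (f : X -> Y) (k : R) :=
  0 <= k /\ forall x y, mdist (f x) (f y) <= k * mdist x y.

Definition Lip0 : set (X -> Y) :=
  [set f | f (pm_base X) = pm_base Y /\ exists k, lip_bound f k].

Definition Lip (f : X -> Y) : R := inf [set k | lip_bound f k].

End lipschitz.

(* The library puts on [set_type A] the pseudometric induced by the ambient
   space; here it is shown to come from the restricted distance. *)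
Section metric_subset.
Variables (R : realType) (X : metricType R) (A : set X).

Let d (x y : A) : R := mdist (set_val x) (set_val y).

Let d_ge0 x y : 0 <= d x y. Proof. exact: mdist_ge0. Qed.

Let d_pos x y : d x y = 0 -> x = y.
Proof. by move=> /mdist_positivity/val_inj. Qed.

Let ballEd (x : A) (e : R) : ball x e = [set y | d x y < e].
Proof.
by rewrite -[LHS]initial_ballE ballEmdist.
Qed.

HB.instance Definition _ :=
  PseudoMetric_isMetric.Build R (set_type A) d_ge0 d_pos ballEd.

Lemma mdist_set_type (x y : A) : mdist x y = mdist (set_val x) (set_val y).
Proof. by []. Qed.

End metric_subset.

Record finPSubset (R : realType) (X : pmetricType R) := FinPSubset {
  fps_set :> set X ;
  fps_finite : finite_set fps_set ;
  fps_base : fps_set (pm_base X) }.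

Definition pmetric_sub (R : realType) (X : pmetricType R) (X0 : finPSubset X) :
    pmetricType R :=
  PMetric (set_type (fps_set X0)) (SigSub (mem_set (fps_base X0))).

Definition incl (R : realType) (X : pmetricType R) (X0 : finPSubset X) :
  pmetric_sub X0 -> X := set_val.

Definition banach_metric (R : realType) (E : completeNormedModType R) : Type :=
  E.

Section banach_metric.
Variables (R : realType) (E : completeNormedModType R).

HB.instance Definition _ := PseudoMetric.copy (banach_metric E) E.

Let d (x y : banach_metric E) : R := `|(x : E) - (y : E)|.

Let d_ge0 x y : 0 <= d x y. Proof. exact: normr_ge0. Qed.

Let d_pos x y : d x y = 0 -> x = y.
Proof. by move=> /normr0_eq0/eqP; rewrite subr_eq0 => /eqP. Qed.

Let ballEd (x : banach_metric E) (e : R) : ball x e = [set y | d x y < e].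
Proof. by rewrite -[RHS]/(ball_ (@Num.norm R E) x e) ball_normE. Qed.

HB.instance Definition _ :=
  PseudoMetric_isMetric.Build R (banach_metric E) d_ge0 d_pos ballEd.

End banach_metric.

Definition pmetric_of (R : realType) (E : completeNormedModType R) :
  pmetricType R := PMetric (banach_metric E) (0 : E).

Lemma mdist_pmetric_of (R : realType) (E : completeNormedModType R) (x y : E) :
  mdist (x : pmetric_of E) (y : pmetric_of E) = `|x - y|.
Proof. by []. Qed.

Record blin (R : realType) (E F : completeNormedModType R) := BLin {
  blin_fun :> E -> F ;
  blin_linear : linear blin_fun ;
  blin_continuous : continuous blin_fun }.

Section blin.
Variables (R : realType) (E F : completeNormedModType R).
Implicit Types (S T : blin E F).

HB.instance Definition _ S :=
  GRing.isLinear.Build R E F *:%R (blin_fun S) (@blin_linear _ _ _ S).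

HB.instance Definition _ := gen_eqMixin (blin E F).
HB.instance Definition _ := gen_choiceMixin (blin E F).

Lemma blinP S T : (forall x, S x = T x) -> S = T.
Proof.
case: S => f fl fc; case: T => g gl gc /= /funext fg.
by move: fl fc gl gc; rewrite fg => *; congr BLin; exact: Prop_irrelevance.
Qed.

Definition op_bound (f : E -> F) (k : R) :=
  0 <= k /\ forall x, `|f x| <= k * `|x|.

Definition opnorm S : R := inf [set k | op_bound S k].

Lemma blin_bounded S : exists k, op_bound S k.
Proof.
have /linear_bounded_continuous/linear_boundedP[M [Mr hM]] :=
  @blin_continuous _ _ _ S.
exists (`|M| + 1); split; first by rewrite addr_ge0.
by move=> x; apply: hM; rewrite ltr_pwDr// real_ler_norm.
Qed.

Lemma op_bound_continuous (f : E -> F) k :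
  linear f -> op_bound f k -> continuous f.
Proof.
move=> fl [k0 fk].
pose g : {linear E -> F} := HB.pack f (GRing.isLinear.Build _ _ _ _ _ fl).
apply: (@bounded_linear_continuous R E F g); apply/linear_boundedP.
near=> M => x; rewrite (le_trans (fk x))// ler_wpM2r//.
by near: M; apply: nbhs_pinfty_ge; rewrite num_real.
Unshelve. all: by end_near. Qed.

Lemma opnorm_ge0 S : 0 <= opnorm S.
Proof. by apply: lb_le_inf; [exact: blin_bounded|move=> k []]. Qed.

Lemma opnormP S x : `|S x| <= opnorm S * `|x|.
Proof.
have [->|x0] := eqVneq x 0; first by rewrite linear0 !normr0 mulr0.
rewrite -ler_pdivrMr ?normr_gt0//; apply: lb_le_inf; first exact: blin_bounded.
by move=> k [_ Sk]; rewrite ler_pdivrMr ?normr_gt0.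
Qed.

Lemma opnorm_le S k : 0 <= k -> (forall x, `|S x| <= k * `|x|) -> opnorm S <= k.
Proof. by move=> k0 Sk; apply: ge_inf; [exists 0 => ? []|split]. Qed.

Lemma blin0_subproof : op_bound (fun _ : E => 0 : F) 0.
Proof. by split=> // x; rewrite normr0 mul0r. Qed.

Lemma blinZD_linear a S T : linear (fun x => a *: S x + T x).
Proof.
move=> b x y /=; rewrite !blin_linear !scalerDr !scalerA mulrC -!addrA.
by congr (_ + _); rewrite addrCA.
Qed.

Lemma blinZD_continuous a S T : continuous (fun x => a *: S x + T x).
Proof.
move=> x; apply: cvgD; last exact: blin_continuous.
by apply: cvgZr; exact: blin_continuous.
Qed.

Definition blinZD a S T := 
  BLin (@blinZD_linear a S T) (@blinZD_continuous a S T).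

Lemma blin0_linear : linear (fun _ : E => 0 : F).
Proof. by move=> a x y; rewrite scaler0 addr0. Qed.

Definition blin0 := BLin blin0_linear (@cst_continuous _ _ _).
Definition blin_opp S := blinZD (-1) S blin0.
Definition blin_add S T := blinZD 1 S T.
Definition blin_scale a S := blinZD a S blin0.

Lemma blin_addA : associative blin_add.
Proof. by move=> S T U; apply: blinP => x /=; rewrite !scale1r addrA. Qed.
Lemma blin_addC : commutative blin_add.
Proof. by move=> S T; apply: blinP => x /=; rewrite !scale1r addrC. Qed.
Lemma blin_add0 : left_id blin0 blin_add.
Proof. by move=> S; apply: blinP => x /=; rewrite !scale1r add0r. Qed.
Lemma blin_addN : left_inverse blin0 blin_opp blin_add.
Proof.
by move=> S; apply: blinP => x /=; rewrite !scale1r scaleN1r addr0 addNr.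
Qed.

HB.instance Definition _ := GRing.isZmodule.Build (blin E F)
  blin_addA blin_addC blin_add0 blin_addN.

Lemma blin_addE S T x : (S + T) x = S x + T x.
Proof. by rewrite /= scale1r. Qed.

Lemma blin_scaleA a b S :
  blin_scale a (blin_scale b S) = blin_scale (a * b) S.
Proof. by apply: blinP => x /=; rewrite !addr0 scalerA. Qed.
Lemma blin_scale1 : left_id 1 blin_scale.
Proof. by move=> S; apply: blinP => x /=; rewrite addr0 scale1r. Qed.
Lemma blin_scaleDr : right_distributive blin_scale +%R.
Proof.
by move=> a S T; apply: blinP => x /=; rewrite !addr0 !scale1r scalerDr.
Qed.
Lemma blin_scaleDl S : {morph blin_scale^~ S : a b / a + b}.
Proof.
by move=> a b; apply: blinP => x /=; rewrite !addr0 scale1r scalerDl.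
Qed.

HB.instance Definition _ := GRing.Zmodule_isLmodule.Build R (blin E F)
  blin_scaleA blin_scale1 blin_scaleDr blin_scaleDl.

Lemma blin_scaleE a S x : (a *: S) x = a *: S x.
Proof. by rewrite /= addr0. Qed.

Lemma blin_oppE S x : (- S) x = - S x.
Proof. by rewrite /= scaleN1r addr0. Qed.

Lemma blin_sumE (x : nat -> blin E F) n v :
  (\sum_(k < n) x k) v = \sum_(k < n) x k v.
Proof.
by elim: n => [|n IH]; rewrite ?big_ord0// !big_ord_recr blin_addE IH.
Qed.

Lemma opnormD S T : opnorm (S + T) <= opnorm S + opnorm T.
Proof.
apply: opnorm_le => [|x]; first by rewrite addr_ge0 ?opnorm_ge0.
by rewrite blin_addE mulrDl (le_trans (ler_normD _ _))// lerD ?opnormP.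
Qed.

Lemma opnormZ a S : opnorm (a *: S) = `|a| * opnorm S.
Proof.
apply/eqP; rewrite eq_le; apply/andP; split.
  apply: opnorm_le => [|x]; first by rewrite mulr_ge0 ?opnorm_ge0.
  by rewrite blin_scaleE normrZ -mulrA ler_wpM2l ?opnormP.
have [->|a0] := eqVneq a 0; first by rewrite normr0 mul0r opnorm_ge0.
rewrite mulrC -ler_pdivlMr ?normr_gt0//; apply: opnorm_le => [|x].
  by rewrite divr_ge0// opnorm_ge0.
rewrite mulrAC ler_pdivlMr ?normr_gt0// mulrC -normrZ -blin_scaleE.
exact: opnormP.
Qed.

Lemma opnorm_eq0 S : opnorm S = 0 -> S = 0.
Proof.
move=> S0; apply: blinP => x; rewrite -[RHS]/(0 : F).
apply/eqP; rewrite -normr_le0.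
by have := opnormP S x; rewrite S0 mul0r.
Qed.

HB.instance Definition _ :=
  Lmodule_isNormed.Build R (blin E F) opnormD opnormZ opnorm_eq0.

Lemma blin_normE S : `|S| = opnorm S. Proof. by []. Qed.

Lemma blin_complete (G : set_system (blin E F)) :
  ProperFilter G -> cauchy G -> cvg G.
Proof.
move: G; apply: geometric_complete => S Sn.
have /choice[s sP] : forall x, exists y : F,
    forall n, `|y - \sum_(k < n) S k x| <= 2 * `|x| * 2^-1 ^+ n.
  move=> x; apply: (@geometric_sum R F `|x| (fun k => S k x)) => n.
  by rewrite (le_trans (opnormP _ _))// mulrC ler_wpM2l//; exact: Sn.
have lim_eq (y : F) (C : R) : (forall n, `|y| <= C * 2^-1 ^+ n) -> y = 0.
  move=> yC; apply/eqP; rewrite -normr_le0; apply/ler_addgt0Pl => e e0.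
  have C0 : 0 <= C by have := yC 0%N; rewrite expr0 mulr1; apply: le_trans.
  have [n hn] : exists n, 2^-1 ^+ n < e / (C + 1).
    by apply: hX_le; rewrite divr_gt0// ltr_wpDl.
  move: hn; rewrite ltr_pdivlMr ?ltr_wpDl// mulrDr mulr1 mulrC addr0 => hn.
  by have := hX_gt0 R n; have := yC n; lra.
have sl : linear s.
  move=> a x y; apply/eqP; rewrite -subr_eq0; apply/eqP.
  pose C := 2 * `|a *: x + y| + `|a| * (2 * `|x|) + 2 * `|y|.
  apply: (lim_eq _ C) => n.
  have -> : s (a *: x + y) - (a *: s x + s y) =
      (s (a *: x + y) - \sum_(k < n) S k (a *: x + y))
      - (a *: (s x - \sum_(k < n) S k x)) - (s y - \sum_(k < n) S k y).
    rewrite -!blin_sumE blin_linear scalerBr !opprB -[RHS]addrA [X in _ = _ + X]addrACA.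
    by rewrite -opprD addrA subrK.
  rewrite (le_trans (ler_normB _ _))// /C 2!mulrDl lerD//.
  rewrite (le_trans (ler_normB _ _))// lerD// normrZ -mulrA ler_wpM2l//.
have sb : op_bound s 2.
  by split=> // x; have := sP x 0%N; rewrite big_ord0 subr0 expr0 mulr1.
exists 2, (BLin sl (op_bound_continuous sl sb)) => n.
apply: opnorm_le => [|x]; first by rewrite mulr_ge0 ?ltW ?hX_gt0.
by rewrite blin_addE blin_oppE blin_sumE mulrAC; exact: sP.
Qed.

HB.instance Definition _ := Uniform_isComplete.Build (blin E F) blin_complete.

End blin.

Definition dual (R : realType) (E : completeNormedModType R) :
  completeNormedModType R := blin E R^o.

Definition bidual (R : realType) (E : completeNormedModType R) :
  completeNormedModType R := dual (dual E).

Section canonical_inclusion.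
Variables (R : realType) (E : completeNormedModType R).

Let ev (x : E) (phi : dual E) : R^o := phi x.

Let ev_linear x : linear (ev x).
Proof. by move=> a S T; rewrite /ev blin_addE blin_scaleE. Qed.

Let ev_bound x : op_bound (ev x) `|x|.
Proof. by split=> // phi; rewrite mulrC; exact: opnormP. Qed.

Definition canon_incl (x : E) : bidual E :=
  BLin (@ev_linear x) (op_bound_continuous (@ev_linear x) (ev_bound x)).

Lemma canon_inclE x phi : canon_incl x phi = phi x. Proof. by []. Qed.

End canonical_inclusion.

Record cseminorm (R : realType) (V : lmodType R) := CSeminorm {
  sn_fun :> V -> R ;
  snD : forall x y, sn_fun (x + y) <= sn_fun x + sn_fun y ;
  snZ : forall a x, sn_fun (a *: x) = `|a| * sn_fun x ;
  sn_complete : forall x : nat -> V, (forall n, sn_fun (x n) <= 2^-1 ^+ n) ->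
    exists C s, forall n, sn_fun (s - \sum_(k < n) x k) <= C * 2^-1 ^+ n }.

Section null_space.
Variables (R : realType) (V : lmodType R) (p : cseminorm V).

Definition null_space : {pred V} := [pred x | p x == 0].

Lemma sn0 : p 0 = 0. Proof. by rewrite -(scale0r 0) snZ normr0 mul0r. Qed.
Lemma snN x : p (- x) = p x. Proof. by rewrite -scaleN1r snZ normrN1 mul1r. Qed.

Lemma sn_ge0 x : 0 <= p x.
Proof. by have := snD p x (- x); rewrite subrr sn0 snN; lra. Qed.

Lemma sn_distC x y : p (x - y) = p (y - x). Proof. by rewrite -opprB snN. Qed.

Lemma sn_sub_le x y : p (x - y) = 0 -> p x <= p y.
Proof. by move=> xy; have := snD p (x - y) y; rewrite subrK xy add0r. Qed.

Lemma null_space_zmod : zmod_closed null_space.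
Proof.
split=> [|x y]; rewrite !inE ?sn0// => /eqP x0 /eqP y0.
by rewrite eq_le sn_ge0 andbT (le_trans (snD p _ _))// snN x0 y0 addr0.
Qed.

HB.instance Definition _ := GRing.isZmodClosed.Build V null_space
  null_space_zmod.

End null_space.

Definition sepquot (R : realType) (V : lmodType R) (p : cseminorm V) : Type :=
  Quotient.quot (null_space p).

Section sepquot.
Variables (R : realType) (V : lmodType R) (p : cseminorm V).
Local Notation Q := (sepquot p).

HB.instance Definition _ := GRing.Zmodule.on Q.

Definition spi : V -> Q :=
  (\pi_(Quotient.quot (null_space p)))%qT.
Definition srepr : Q -> V := repr.

Lemma spiP x y : (spi x = spi y) <-> p (x - y) = 0.
Proof.
have E := Quotient.idealrBE (null_space p) x y.
by rewrite inE in E; split=> [xy|/eqP]; [apply/eqP; rewrite E; exact/eqP|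
  rewrite E => /eqP].
Qed.

Lemma sreprK : cancel srepr spi. Proof. exact: reprK. Qed.

Lemma spiK x : p (srepr (spi x) - x) = 0.
Proof. by apply/spiP; rewrite sreprK. Qed.

Lemma spiD x y : spi (x + y) = spi x + spi y. Proof. exact: raddfD. Qed.
Lemma spiB x y : spi (x - y) = spi x - spi y. Proof. exact: raddfB. Qed.

Definition sscale a (q : Q) : Q := spi (a *: srepr q).

Lemma sscale_spi a x : sscale a (spi x) = spi (a *: x).
Proof. by apply/spiP; rewrite -scalerBr snZ spiK mulr0. Qed.

Lemma sscaleA a b q : sscale a (sscale b q) = sscale (a * b) q.
Proof. by rewrite -(sreprK q) !sscale_spi scalerA. Qed.
Lemma sscale1 : left_id 1 sscale.
Proof. by move=> q; rewrite -(sreprK q) !sscale_spi scale1r. Qed.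
Lemma sscaleDr : right_distributive sscale +%R.
Proof.
move=> a q r; rewrite -(sreprK q) -(sreprK r) -spiD !sscale_spi -spiD.
by rewrite scalerDr.
Qed.
Lemma sscaleDl q : {morph sscale^~ q : a b / a + b}.
Proof. by move=> a b; rewrite -(sreprK q) !sscale_spi -spiD scalerDl. Qed.

HB.instance Definition _ := GRing.Zmodule_isLmodule.Build R Q
  sscaleA sscale1 sscaleDr sscaleDl.

Lemma spiZ a x : spi (a *: x) = a *: spi x.
Proof. by rewrite -sscale_spi. Qed.

Lemma spi_linear : linear spi.
Proof. by move=> a x y; rewrite spiD spiZ. Qed.

Definition snorm (q : Q) : R := p (srepr q).

Lemma snorm_spi x : snorm (spi x) = p x.
Proof.
by apply/eqP; rewrite eq_le !sn_sub_le ?spiK// sn_distC spiK.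
Qed.

Lemma snormD q r : snorm (q + r) <= snorm q + snorm r.
Proof.
by rewrite -(sreprK q) -(sreprK r) -spiD !snorm_spi; exact: snD.
Qed.
Lemma snormZ a q : snorm (a *: q) = `|a| * snorm q.
Proof. by rewrite -(sreprK q) -spiZ !snorm_spi snZ. Qed.
Lemma snorm_eq0 q : snorm q = 0 -> q = 0.
Proof.
rewrite -(sreprK q) snorm_spi => q0; rewrite -(subrr (spi 0)) -spiB.
by apply/spiP; rewrite subrr subr0.
Qed.

HB.instance Definition _ := Lmodule_isNormed.Build R Q snormD snormZ snorm_eq0.

Lemma norm_spi x : `|spi x| = p x. Proof. exact: snorm_spi. Qed.

Lemma spi_sum (x : nat -> V) n : spi (\sum_(k < n) x k) = \sum_(k < n) spi (x k).
Proof.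
elim: n => [|n IH]; last by rewrite !big_ord_recr/= spiD IH.
by rewrite !big_ord0 -(subrr 0) spiB subrr.
Qed.

Lemma sepquot_complete (G : set_system Q) : ProperFilter G -> cauchy G -> cvg G.
Proof.
move: G; apply: geometric_complete => q qn.
have /sn_complete[C [s sP]] : forall n, p (srepr (q n)) <= 2^-1 ^+ n by [].
exists C, (spi s) => n; have := sP n; 
  rewrite -norm_spi spiB (spi_sum (fun k => srepr (q k))).
by under eq_bigr do rewrite sreprK.
Qed.

HB.instance Definition _ := Uniform_isComplete.Build Q sepquot_complete.

End sepquot.

Record closedSubspace (R : realType) (E : completeNormedModType R) :=
  ClosedSubspace {
    cs_set :> set E ;
    cs0 : cs_set 0 ;
    csZD : forall a x y, cs_set x -> cs_set y -> cs_set (a *: x + y) ;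
    cs_closed : closed cs_set }.

Section quotient_space.
Variables (R : realType) (E : completeNormedModType R) (L : closedSubspace E).

Definition dist_to (x : E) : R := inf [set `|x + l| | l in L].

Lemma dist_to_has_inf x : has_inf [set `|x + l| | l in L].
Proof.
split; first by exists `|x + 0|, 0 => //; exact: cs0.
by exists 0 => _ [l _ <-].
Qed.

Lemma dist_to_ge0 x : 0 <= dist_to x.
Proof. by apply: lb_le_inf => [|_ [l _ <-]]; case: (dist_to_has_inf x). Qed.

Lemma dist_to_le x l : cs_set L l -> dist_to x <= `|x + l|.
Proof. by move=> Ll; apply: ge_inf; [case: (dist_to_has_inf x)|exists l]. Qed.

Lemma dist_to_lt x e : 0 < e ->
  exists2 l, cs_set L l & `|x + l| < dist_to x + e.
Proof.
move=> /inf_adherent/(_ (dist_to_has_inf x))[_ [l Ll <-] xl].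
by exists l.
Qed.

Lemma csD x y : cs_set L x -> cs_set L y -> cs_set L (x + y).
Proof. by move=> Lx Ly; rewrite -(scale1r x); exact: csZD. Qed.

Lemma csZ a x : cs_set L x -> cs_set L (a *: x).
Proof. by move=> Lx; rewrite -(addr0 (a *: x)); apply: csZD => //; exact: cs0. Qed.

Lemma cs_sum (l : nat -> E) n :
  (forall k, cs_set L (l k)) -> cs_set L (\sum_(k < n) l k).
Proof.
move=> Ll; elim: n => [|n IH]; first by rewrite big_ord0; exact: cs0.
by rewrite big_ord_recr/=; exact: csD.
Qed.

Lemma dist_toD x y : dist_to (x + y) <= dist_to x + dist_to y.
Proof.
apply/ler_addgt0Pl => e e0; have e20 : 0 < e / 2 by rewrite divr_gt0.
have [l Ll xl] := dist_to_lt x e20; have [m Lm ym] := dist_to_lt y e20.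
have := dist_to_le (x + y) (csD Ll Lm); rewrite addrACA => /le_trans.
by apply; have := ler_normD (x + l) (y + m); lra.
Qed.

Let dist_toZ_le a x : dist_to (a *: x) <= `|a| * dist_to x.
Proof.
apply/ler_addgt0Pl => e e0.
have e20 : 0 < e / (`|a| + 1) by rewrite divr_gt0// ltr_wpDl.
have [l Ll xl] := dist_to_lt x e20.
have := dist_to_le (a *: x) (csZ a Ll); rewrite -scalerDr normrZ => /le_trans.
apply; rewrite (le_trans (ler_wpM2l (normr_ge0 a) (ltW xl)))//.
rewrite mulrDr addrC lerD2r mulrA ler_pdivrMr ?ltr_wpDl//.
by rewrite mulrC ler_wpM2l ?(ltW e0)// lerDl.
Qed.

Lemma dist_toZ a x : dist_to (a *: x) = `|a| * dist_to x.
Proof.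
apply/eqP; rewrite eq_le dist_toZ_le/=.
have [->|a0] := eqVneq a 0; first by rewrite normr0 mul0r dist_to_ge0.
rewrite mulrC -ler_pdivlMr ?normr_gt0// mulrC -normfV.
by apply: le_trans (dist_toZ_le _ _); rewrite scalerA mulVf// scale1r.
Qed.

Lemma dist_to_complete (x : nat -> E) : (forall n, dist_to (x n) <= 2^-1 ^+ n) ->
  exists C s, forall n, dist_to (s - \sum_(k < n) x k) <= C * 2^-1 ^+ n.
Proof.
move=> xn.
have /choice[l lP] : forall n,
    exists m, cs_set L m /\ `|x n + m| <= 2 * 2^-1 ^+ n.
  move=> n; have [m Lm xm] := dist_to_lt (x n) (hX_gt0 R n).
  by exists m; split => //; have := xn n; move: xm; lra.
have [s sP] := geometric_sum (fun n => (lP n).2).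
exists (2 * 2), s => n; apply: le_trans (sP n).
rewrite big_split/= opprD addrA; apply: dist_to_le.
rewrite -scaleN1r; apply/csZ/cs_sum => k; exact: (lP k).1.
Qed.

Definition dist_seminorm : cseminorm E :=
  CSeminorm dist_toD dist_toZ dist_to_complete.

Lemma dist_to_eq0 x : dist_to x = 0 <-> cs_set L x.
Proof.
split=> [x0|Lx]; last first.
  apply/eqP; rewrite eq_le dist_to_ge0 andbT.
  have := dist_to_le x (csZ (-1) Lx).
  by rewrite scaleN1r subrr normr0.
apply: (@cs_closed _ _ L) => A /nbhs_ballP[e /= e0 eA].
have [l Ll] := dist_to_lt x e0; rewrite x0 add0r => xl.
exists (- l); split; first by rewrite -scaleN1r; exact: csZ.
by apply: eA; rewrite -ball_normE /= opprK.
Qed.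

(* The null space of [dist_seminorm] is [L], see [dist_to_eq0]. *)
Definition quotient_space : completeNormedModType R := sepquot dist_seminorm.

Definition quotient_map : E -> quotient_space := @spi R E dist_seminorm.

Lemma quotient_mapP x y : quotient_map x = quotient_map y <-> cs_set L (x - y).
Proof. by rewrite -dist_to_eq0; exact: spiP. Qed.

Lemma norm_quotient_map x : `|quotient_map x| = inf [set `|x + l| | l in L].
Proof. exact: norm_spi. Qed.

End quotient_space.

Record finCodimSubspace (R : realType) (E : completeNormedModType R) :=
  FinCodimSubspace {
    fc_subspace :> closedSubspace E ;
    (* the classes of the [v i] span the quotient by [fc_subspace] *)
    fc_codim : exists n (v : 'I_n -> E), forall x, exists c : 'I_n -> R,
      cs_set fc_subspace (x - \sum_i c i *: v i) }.

Record ultrafilter (T : Type) := Ultrafilter {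
  uf_set :> set_system T ;
  uf_ultra : UltraFilter uf_set }.

#[export] Existing Instance uf_ultra.

Section ultralimits.
Variables (R : realType) (T : Type) (U : ultrafilter T).
Implicit Types u v : T -> R.

Lemma ultra_map (S : Type) (f : T -> S) : UltraFilter (f @ uf_set U).
Proof.
split=> [|G PG UG]; first exact: fmap_proper_filter.
apply/seteqP; split=> // A GA.
have [//|UA] := in_ultra_setVsetC (f @^-1` A) (uf_ultra U).
have /(filterI GA) : G (~` A) by exact: UG.
by rewrite setICr => /filter_not_empty.
Qed.

Lemma ultra_cvg u M : (forall i, `|u i| <= M) -> cvg (u @ uf_set U).
Proof.
move=> uM; have := @segment_compact R (- M) M.
rewrite compact_ultra => /(_ _ (ultra_map u)).
case=> [|l [_ ul]]; last by apply/cvg_ex; exists l.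
by apply: (@filterE _ (uf_set U)) => i; rewrite /= in_itv/= -ler_norml.
Qed.

Lemma ultra_cvg_le u v a b : u @ uf_set U --> a -> v @ uf_set U --> b ->
  uf_set U [set i | u i <= v i] -> a <= b.
Proof.
move=> ua vb uv; rewrite -subr_ge0.
apply: (@closed_cvg _ _ (uf_set U) _ (v \- u) [set y : R | 0 <= y]).
- exact: closed_ge.
- by apply: filterS uv => i /=; rewrite subr_ge0.
- exact: cvgB.
Qed.

Lemma ultra_lim_le u v M N :
  (forall i, `|u i| <= M) -> (forall i, `|v i| <= N) ->
  uf_set U [set i | u i <= v i] -> lim (u @ uf_set U) <= lim (v @ uf_set U).
Proof.
move=> uM vN; exact: ultra_cvg_le (ultra_cvg uM) (ultra_cvg vN).
Qed.

Lemma ultra_lim_lt u M c : (forall i, `|u i| <= M) -> lim (u @ uf_set U) < c ->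
  uf_set U [set i | u i < c].
Proof.
by move=> uM uc; have := ultra_cvg uM => /cvgr_lt; apply.
Qed.

Lemma ultra_lim_bound u M c :
  (forall i, `|u i| <= M) -> uf_set U [set i | u i <= c] -> lim (u @ uf_set U) <= c.
Proof.
move=> uM uc; rewrite -[leRHS](@lim_cst R _ T (uf_set U) _ c)//.
exact: ultra_lim_le uM (fun=> lexx `|c|) uc.
Qed.

End ultralimits.

Record bfam (R : realType) (T : Type) (E : T -> completeNormedModType R) := BFam {
  bf_fun :> forall i, E i ;
  bf_bounded : exists M, forall i, `|bf_fun i| <= M }.

Section bounded_families.
Variables (R : realType) (T : Type) (E : T -> completeNormedModType R).
Implicit Types x y : bfam E.

HB.instance Definition _ := gen_eqMixin (bfam E).
HB.instance Definition _ := gen_choiceMixin (bfam E).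

Lemma bfamP x y : (forall i, x i = y i) -> x = y.
Proof.
case: x => f fb; case: y => g gb /= fg.
have {}fg : f = g by exact: functional_extensionality_dep.
by move: fb gb; rewrite fg => *; congr BFam; exact: Prop_irrelevance.
Qed.

Lemma bfam0_bounded : exists M : R, forall i, `|0 : E i| <= M.
Proof. by exists 0 => i; rewrite normr0. Qed.
Definition bfam0 : bfam E := BFam bfam0_bounded.

Lemma bfam_opp_bounded x : exists M, forall i, `|- x i| <= M.
Proof. by case: x => f [M fM]; exists M => i; rewrite normrN. Qed.
Definition bfam_opp x : bfam E := BFam (bfam_opp_bounded x).

Lemma bfam_add_bounded x y : exists M, forall i, `|x i + y i| <= M.
Proof.
case: x => f [M fM]; case: y => g [N gN]; exists (M + N) => i.
by rewrite (le_trans (ler_normD _ _))// lerD.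
Qed.
Definition bfam_add x y : bfam E := BFam (bfam_add_bounded x y).

Lemma bfam_scale_bounded (a : R) x : exists M, forall i, `|a *: x i| <= M.
Proof.
case: x => f [M fM]; exists (`|a| * M) => i /=.
by rewrite normrZ; apply: ler_wpM2l (fM i).
Qed.
Definition bfam_scale a x : bfam E := BFam (bfam_scale_bounded a x).

Lemma bfam_addA : associative bfam_add.
Proof. by move=> x y z; apply: bfamP => i /=; rewrite addrA. Qed.
Lemma bfam_addC : commutative bfam_add.
Proof. by move=> x y; apply: bfamP => i /=; rewrite addrC. Qed.
Lemma bfam_add0 : left_id bfam0 bfam_add.
Proof. by move=> x; apply: bfamP => i /=; rewrite add0r. Qed.
Lemma bfam_addN : left_inverse bfam0 bfam_opp bfam_add.
Proof. by move=> x; apply: bfamP => i /=; rewrite addNr. Qed.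

HB.instance Definition _ := GRing.isZmodule.Build (bfam E)
  bfam_addA bfam_addC bfam_add0 bfam_addN.

Lemma bfam_scaleA a b x : bfam_scale a (bfam_scale b x) = bfam_scale (a * b) x.
Proof. by apply: bfamP => i /=; rewrite scalerA. Qed.
Lemma bfam_scale1 : left_id 1 bfam_scale.
Proof. by move=> x; apply: bfamP => i /=; rewrite scale1r. Qed.
Lemma bfam_scaleDr : right_distributive bfam_scale +%R.
Proof. by move=> a x y; apply: bfamP => i /=; rewrite scalerDr. Qed.
Lemma bfam_scaleDl x : {morph bfam_scale^~ x : a b / a + b}.
Proof. by move=> a b; apply: bfamP => i /=; rewrite scalerDl. Qed.

HB.instance Definition _ := GRing.Zmodule_isLmodule.Build R (bfam E)
  bfam_scaleA bfam_scale1 bfam_scaleDr bfam_scaleDl.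

Lemma bfam_sumE (x : nat -> bfam E) n i :
  (\sum_(k < n) x k) i = \sum_(k < n) x k i.
Proof. by elim: n => [|n IH]; rewrite ?big_ord0// !big_ord_recr /= IH. Qed.

Lemma bfam_norm_bounded x : exists M, forall i, `| `|x i| | <= M.
Proof. by case: x => f [M fM]; exists M => i; rewrite normr_id. Qed.

End bounded_families.

Section ultraproduct.
Variables (R : realType) (T : Type) (U : ultrafilter T).
Variable E : T -> completeNormedModType R.
Implicit Types x y : bfam E.

Definition ulim_norm x : R := lim (`|x i| @[i --> uf_set U]).

Lemma ulim_normP x : `|x i| @[i --> uf_set U] --> ulim_norm x.
Proof. by have [M xM] := bfam_norm_bounded x; exact: ultra_cvg xM. Qed.

Lemma ulim_normD x y : ulim_norm (x + y) <= ulim_norm x + ulim_norm y.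
Proof.
apply: (ultra_cvg_le (@ulim_normP (x + y))
  (cvgD (@ulim_normP x) (@ulim_normP y))).
by apply: nearW => i; exact: ler_normD.
Qed.

Lemma ulim_normZ a x : ulim_norm (a *: x) = `|a| * ulim_norm x.
Proof.
have ax : `|a| * `|x i| @[i --> uf_set U] --> `|a| * ulim_norm x.
  exact: cvgM (cvg_cst _) (@ulim_normP x).
have axE : (fun i => `|(a *: x) i|) = (fun i => `|a| * `|x i|).
  by apply/funext => i; exact: normrZ.
by rewrite {1}/ulim_norm axE; exact: cvg_lim ax.
Qed.

Lemma ulim_norm_le x c : uf_set U [set i | `|x i| <= c] -> ulim_norm x <= c.
Proof. by have [M xM] := bfam_norm_bounded x; exact: ultra_lim_bound xM. Qed.

Lemma ulim_norm_complete (x : nat -> bfam E) :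
  (forall n, ulim_norm (x n) <= 2^-1 ^+ n) ->
  exists C s, forall n, ulim_norm (s - \sum_(k < n) x k) <= C * 2^-1 ^+ n.
Proof.
move=> xn; pose W n := [set i | `|x n i| < 2 * 2^-1 ^+ n].
have UW n : uf_set U (W n).
  have [M xM] := bfam_norm_bounded (x n); apply: (ultra_lim_lt xM).
  by rewrite (le_lt_trans (xn n))// ltr_pMl ?hX_gt0 ?ltr1n.
pose y n i : E i := if `[< W n i >] then x n i else 0.
have yn i n : `|y n i| <= 2 * 2^-1 ^+ n.
  rewrite /y; case: asboolP => [/ltW//|_].
  by rewrite normr0 mulr_ge0// ltW ?hX_gt0.
have sex i : exists s : E i, forall n,
    `|s - \sum_(k < n) y k i| <= 2 * 2 * 2^-1 ^+ n.
  exact: geometric_sum (yn i).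
pose s i := projT1 (cid (sex i)).
have sP i n : `|s i - \sum_(k < n) y k i| <= 2 * 2 * 2^-1 ^+ n.
  exact: (projT2 (cid (sex i))).
have sb : exists M, forall i, `|s i| <= M.
  exists (2 * 2) => i; have := sP i 0%N.
  by rewrite big_ord0 subr0 expr0 mulr1.
exists (2 * 2), (BFam sb) => n; apply: ulim_norm_le.
have : uf_set U [set i | forall k : 'I_n, W k i].
  by apply: filter_forall => k; exact: UW.
apply: filterS => i /= Wi; have := sP i n.
congr (`|_ - _| <= _); rewrite bfam_sumE; apply: eq_bigr => k _.
by rewrite /y asboolT.
Qed.

Definition ulim_seminorm : cseminorm (bfam E) :=
  CSeminorm ulim_normD ulim_normZ ulim_norm_complete.

Definition ultraproduct : completeNormedModType R := sepquot ulim_seminorm.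

Definition uclass (x : bfam E) : ultraproduct := @spi R (bfam E) ulim_seminorm x.

Lemma norm_uclass x : `|uclass x| = lim (`|x i| @[i --> uf_set U]).
Proof. exact: norm_spi. Qed.

Lemma uclassP x y : uclass x = uclass y <-> lim (`|x i - y i| @[i --> uf_set U]) = 0.
Proof. exact: spiP. Qed.

End ultraproduct.

Record bpfam (R : realType) (T : Type) (X : T -> pmetricType R) := BPFam {
  bp_fun :> forall i, X i ;
  bp_bounded : exists M : R, forall i, mdist (bp_fun i) (pm_base (X i)) <= M }.

Section metric_ultralimit.
Variables (R : realType) (T : Type) (U : ultrafilter T).
Variable X : T -> pmetricType R.
Implicit Types x y z : bpfam X.

HB.instance Definition _ := gen_eqMixin (bpfam X).
HB.instance Definition _ := gen_choiceMixin (bpfam X).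

Definition ulim_dist x y : R := lim (mdist (x i) (y i) @[i --> uf_set U]).

Lemma mdist_bounded x y : exists M : R, forall i, `|mdist (x i) (y i)| <= M.
Proof.
case: x => f [M fM]; case: y => g [N gN]; exists (M + N) => i /=.
rewrite ger0_norm ?mdist_ge0//.
rewrite (le_trans (metric_triangle _ (pm_base (X i)) _))// lerD//.
by rewrite metric_sym.
Qed.

Lemma ulim_distP x y : mdist (x i) (y i) @[i --> uf_set U] --> ulim_dist x y.
Proof. by have [M xyM] := mdist_bounded x y; exact: ultra_cvg xyM. Qed.

Lemma ulim_distxx x : ulim_dist x x = 0.
Proof.
rewrite /ulim_dist; under eq_fun do rewrite mdistxx.
exact: lim_cst.
Qed.

Lemma ulim_distC x y : ulim_dist x y = ulim_dist y x.
Proof. by rewrite /ulim_dist; under eq_fun do rewrite metric_sym. Qed.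

Lemma ulim_dist_triangle y x z :
  ulim_dist x z <= ulim_dist x y + ulim_dist y z.
Proof.
apply: (ultra_cvg_le (@ulim_distP x z)
  (cvgD (@ulim_distP x y) (@ulim_distP y z))).
by apply: nearW => i; exact: metric_triangle.
Qed.

Lemma ulim_dist_ge0 x y : 0 <= ulim_dist x y.
Proof.
have := ulim_dist_triangle y x x; rewrite ulim_distxx (ulim_distC y x); lra.
Qed.

Definition ulim_eq x y := ulim_dist x y == 0.

Lemma ulim_dist_eql x y z : ulim_dist x y = 0 -> ulim_dist x z = ulim_dist y z.
Proof.
move=> xy; apply/eqP; rewrite eq_le.
have := ulim_dist_triangle y x z; have := ulim_dist_triangle x y z.
by rewrite (ulim_distC y x) xy !add0r => -> ->.
Qed.

Lemma ulim_eq_equiv : equiv_class_of ulim_eq.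
Proof.
split=> [x|x y|y x z]; rewrite /ulim_eq ?ulim_distxx// 1?ulim_distC//.
by move=> /eqP xy; rewrite (ulim_dist_eql _ xy).
Qed.

Canonical ulim_eq_rel := EquivRelPack ulim_eq_equiv.
Canonical ulim_eq_encModRel := defaultEncModRel ulim_eq.

Definition ultralimit_sort : Type := {eq_quot ulim_eq}%qT.

HB.instance Definition _ := Choice.on ultralimit_sort.

Definition pclass x : ultralimit_sort := (\pi_({eq_quot ulim_eq}) x)%qT.
Definition prepr (q : ultralimit_sort) : bpfam X :=
  repr (q : {eq_quot ulim_eq}%qT).

Lemma preprK : cancel prepr pclass. Proof. exact: reprK. Qed.

Lemma pclassP x y :
  pclass x = pclass y <-> lim (mdist (x i) (y i) @[i --> uf_set U]) = 0.
Proof. by split=> [/eqmodP/eqP|xy]; last exact/eqmodP/eqP. Qed.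

Definition ultralimit_dist (q r : ultralimit_sort) : R :=
  ulim_dist (prepr q) (prepr r).

Lemma ultralimit_dist_pclass x y :
  ultralimit_dist (pclass x) (pclass y) = lim (mdist (x i) (y i) @[i --> uf_set U]).
Proof.
have E z : ulim_dist (prepr (pclass z)) z = 0 by apply/pclassP; exact: preprK.
rewrite /ultralimit_dist (ulim_dist_eql _ (E x)) ulim_distC.
by rewrite (ulim_dist_eql _ (E y)) ulim_distC.
Qed.

Lemma ultralimit_distxx q : ultralimit_dist q q = 0.
Proof. exact: ulim_distxx. Qed.
Lemma ultralimit_dist_positivity q r : ultralimit_dist q r = 0 -> q = r.
Proof. by move=> qr; rewrite -(preprK q) -(preprK r); exact/pclassP. Qed.
Lemma ultralimit_distC q r : ultralimit_dist q r = ultralimit_dist r q.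
Proof. exact: ulim_distC. Qed.
Lemma ultralimit_dist_triangle r q s :
  ultralimit_dist q s <= ultralimit_dist q r + ultralimit_dist r s.
Proof. exact: ulim_dist_triangle. Qed.

HB.instance Definition _ := isMetric.Build R ultralimit_sort ultralimit_distxx
  ultralimit_dist_positivity ultralimit_distC ultralimit_dist_triangle.

Lemma bpbase_bounded :
  exists M : R, forall i, mdist (pm_base (X i)) (pm_base (X i)) <= M.
Proof. by exists 0 => i; rewrite mdistxx. Qed.

Definition ultralimit : pmetricType R :=
  PMetric ultralimit_sort (pclass (BPFam bpbase_bounded)).

Lemma mdist_pclass x y : mdist (pclass x : ultralimit) (pclass y) =
  lim (mdist (x i) (y i) @[i --> uf_set U]).
Proof. exact: ultralimit_dist_pclass. Qed.

End metric_ultralimit.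

Section ultraproduct_map.
Variables (R : realType) (T : Type) (U : ultrafilter T).
Variables (X : T -> pmetricType R) (E : T -> completeNormedModType R).
Variable f : forall i, X i -> E i.

(* The zero family if [y] is unbounded, which does not happen for
   [y i = f i (x i)] with [x] bounded and the [f i] uniformly Lipschitz. *)
Definition bfam_of (y : forall i, E i) : bfam E :=
  if pselect (exists M, forall i, `|y i| <= M) is left yb then BFam yb else 0.

Definition ultramap (q : ultralimit U X) : ultraproduct U E :=
  uclass U (bfam_of (fun i => f (prepr q i))).

Variable C : R.
Hypothesis f0 : forall i, f (pm_base (X i)) = 0.
Hypothesis fC : forall i, @lip_bound R (X i) (pmetric_of (E i)) (@f i) C.

Lemma ultramap_bounded (x : bpfam X) : exists M, forall i, `|f (x i)| <= M.
Proof.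
case: x => x [M xM]; exists (C * M) => i /=.
have fx : `|f (x i) - f (pm_base (X i))| <= C * mdist (x i) (pm_base (X i)).
  exact: (fC i).2.
rewrite -(subr0 (f (x i))) -(f0 i) (le_trans fx)//.
exact: ler_wpM2l (fC i).1 _ _ (xM i).
Qed.

Lemma ultramapE (x : bpfam X) :
  ultramap (pclass U x : ultralimit U X) = uclass U (BFam (ultramap_bounded x)).
Proof.
pose r := prepr (pclass U x).
have rx : mdist (r i) (x i) @[i --> uf_set U] --> (0 : R).
  have <- : ulim_dist U r x = 0 by apply/pclassP; exact: preprK.
  exact: ulim_distP.
apply/uclassP; rewrite /bfam_of; case: pselect => [rb /=|]; last first.
  by move=> /(_ (ultramap_bounded r)).
apply: cvg_lim => //.
apply: (@squeeze_cvgr _ _ _ _ (fun=> 0) (fun i => C * mdist (r i) (x i))).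
- apply: nearW => i; rewrite normr_ge0/=; exact: (fC i).2.
- exact: cvg_cst.
- by rewrite -(mulr0 C); exact: cvgM (cvg_cst _) rx.
Qed.

End ultraproduct_map.

(* Components [I(X, E)] and norms; only the values of [lc_norm] on members are
   meaningful. *)
Record lip_class (R : realType) := LipClass {
  lc_mem : forall (X : pmetricType R) (E : completeNormedModType R),
    set (X -> E) ;
  lc_norm : forall (X : pmetricType R) (E : completeNormedModType R),
    (X -> E) -> R }.

Arguments lc_mem {R} I {X E} f : rename.
Arguments lc_norm {R} I {X E} f : rename.

Definition lip_class_eq (R : realType) (I J : lip_class R) : Prop :=
  forall (X : pmetricType R) (E : completeNormedModType R) (f : X -> E),
    (lc_mem I f <-> lc_mem J f) /\ (lc_mem I f -> lc_norm I f = lc_norm J f).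

Record banach_lip_ideal (R : realType) (I : lip_class R) : Prop := {
  bli_Lip0 : forall (X : pmetricType R) (E : completeNormedModType R)
    (f : X -> E), lc_mem I f -> @Lip0 R X (pmetric_of E) f ;
  bli_0 : forall (X : pmetricType R) (E : completeNormedModType R),
    lc_mem I (fun _ : X => 0 : E) ;
  bli_D : forall (X : pmetricType R) (E : completeNormedModType R)
    (f g : X -> E), lc_mem I f -> lc_mem I g -> lc_mem I (fun x => f x + g x) ;
  bli_Z : forall (X : pmetricType R) (E : completeNormedModType R) (a : R)
    (f : X -> E), lc_mem I f -> lc_mem I (fun x => a *: f x) ;
  bli_normD : forall (X : pmetricType R) (E : completeNormedModType R)
    (f g : X -> E), lc_mem I f -> lc_mem I g ->
    lc_norm I (fun x => f x + g x) <= lc_norm I f + lc_norm I g ;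
  bli_normZ : forall (X : pmetricType R) (E : completeNormedModType R) (a : R)
    (f : X -> E), lc_mem I f ->
    lc_norm I (fun x => a *: f x) = `|a| * lc_norm I f ;
  bli_norm_eq0 : forall (X : pmetricType R) (E : completeNormedModType R)
    (f : X -> E), lc_mem I f -> lc_norm I f = 0 -> f = (fun=> 0) ;
  bli_complete : forall (X : pmetricType R) (E : completeNormedModType R)
    (f : nat -> X -> E), (forall n, lc_mem I (f n)) ->
    (forall e : R, 0 < e -> exists N, forall m n, (N <= m)%N -> (N <= n)%N ->
       lc_norm I (fun x => f m x - f n x) < e) ->
    exists2 g : X -> E, lc_mem I g &
      lc_norm I (fun x => f n x - g x) @[n --> \oo] --> (0 : R) ;
  bli_Lip_le : forall (X : pmetricType R) (E : completeNormedModType R)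
    (f : X -> E), lc_mem I f -> @Lip R X (pmetric_of E) f <= lc_norm I f ;
  bli_id : @lc_mem R I (pmetric_of R^o) R^o id ;
  bli_norm_id : @lc_norm R I (pmetric_of R^o) R^o id = 1 ;
  bli_comp : forall (X Y : pmetricType R) (E F : completeNormedModType R)
    (g : Y -> X) (f : X -> E) (S : blin E F), Lip0 g -> lc_mem I f ->
    lc_mem I (S \o f \o g) ;
  bli_norm_comp : forall (X Y : pmetricType R) (E F : completeNormedModType R)
    (g : Y -> X) (f : X -> E) (S : blin E F), Lip0 g -> lc_mem I f ->
    lc_norm I (S \o f \o g) <= `|S| * lc_norm I f * Lip g }.

Section hulls.
Variables (R : realType) (I : lip_class R).

(* The norm, extended by [+oo] outside of the component. For a Banach Lipschitz
   operator ideal the second case does not occur in [max_norm], as the maps there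
   are Lipschitz with finite domain. *)
Definition lc_enorm (X : pmetricType R) (E : completeNormedModType R)
    (f : X -> E) : \bar R :=
  if `[< lc_mem I f >] then (lc_norm I f)%:E else +oo%E.

Definition max_norm (X : pmetricType R) (E : completeNormedModType R)
    (f : X -> E) : \bar R :=
  ereal_sup (range (fun p : finPSubset X * finCodimSubspace E =>
    lc_enorm (@quotient_map R E p.2 \o f \o @incl R X p.1))).

Definition max_hull : lip_class R := {|
  lc_mem := fun X E => [set f | @Lip0 R X (pmetric_of E) f /\
                                (max_norm f < +oo)%E] ;
  lc_norm := fun X E f => fine (max_norm f) |}.

Definition maximal : Prop := lip_class_eq I max_hull.

Definition reg_hull : lip_class R := {|
  lc_mem := fun X E => [set f | @Lip0 R X (pmetric_of E) f /\
                                lc_mem I (@canon_incl R E \o f)] ;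
  lc_norm := fun X E f => lc_norm I (@canon_incl R E \o f) |}.

Definition regular : Prop := lip_class_eq I reg_hull.

Definition ultrastable : Prop :=
  forall (T : Type) (U : ultrafilter T) (X : T -> pmetricType R)
    (E : T -> completeNormedModType R) (f : forall i, X i -> E i),
  (forall i, lc_mem I (f i)) ->
  (exists C : R, forall i, lc_norm I (f i) <= C) ->
  lc_mem I (@ultramap R T U X E f) /\
  lc_norm I (@ultramap R T U X E f) <= lim (lc_norm I (f i) @[i --> uf_set U]).

End hulls.

(* Main.v *)
(* That a maximal ideal is regular rests on finite-dimensional spaces being
   reflexive: the quotient map of [E] by a finite-codimensional [L] extends
   through the canonical inclusion to a norm-one operator from [E'']
   to the quotient.

   For ultrastability, let [F] be the ultraproduct of the [f i], [X0] a
   finite subset of the ultralimit and [q] a finite-codimensional quotient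
   map of the ultraproduct. Choosing representatives gives maps [g i] from
   [X0] to [X i] that are eventually (1 + d)-Lipschitz. A Hahn-Banach
   argument (local duality of ultraproducts) gives operators [S i] from
   [E i] to the quotient, of norm at most 1 + d, with [S i \o f i \o g i]
   close to [q \o F] on [X0]. On a finite metric space the ideal norm is
   controlled by the values of a map, so the ideal norm of the restriction
   of [q \o F] to [X0] is at most the limit of the norms of the [f i].

   Conversely, let [f] be in the maximal hull and take an ultrafilter on
   the pairs (X0, L) that eventually contains every point in X0 and every
   functional in the annihilator of L. The ultraproduct of the local pieces
   of [f], composed with the embedding of [X] in the ultralimit of the X0
   and with the natural map from the ultraproduct of the quotients to [E''], is
   [f] followed by the canonical inclusion; so ultrastability and
   regularity put [f] in the ideal. *)
From HB Require Import structures.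
From mathcomp Require Import all_boot all_order all_algebra.
From mathcomp Require Import ring lra.
From mathcomp Require Import all_classical all_reals.
From mathcomp Require Import ereal topology normedtype sequences.
Require Import Defs.
From mathcomp Require Import reals.

Set Implicit Arguments.
Unset Strict Implicit.
Unset Printing Implicit Defensive.

Import Order.TTheory GRing.Theory Num.Theory.
Import numFieldNormedType.Exports.

Local Open Scope classical_set_scope.
Local Open Scope ring_scope.

(** * Hahn-Banach theorem with cone constraints *)

Section hahn_banach.
Variables (R : realType) (V : lmodType R).
Implicit Types (p : V -> R) (G : V -> R -> Prop).

Record sublinear p : Prop := Sublinear {
  sublinearD : forall x y, p (x + y) <= p x + p y ;
  sublinearZ : forall a x, 0 <= a -> p (a *: x) = a * p x }.

Record convex_cone G : Prop := ConvexCone {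
  cone0 : G 0 0 ;
  coneD : forall v a w b, G v a -> G w b -> G (v + w) (a + b) ;
  coneZ : forall t v a, 0 < t -> G v a -> G (t *: v) (t * a) }.

(** A pair [G v a] encodes the constraint [f v <= a]. For compatible [p] and [G], a linear [f] lies
    below this infimal convolution exactly when it lies below [p] and obeys every constraint. *)
Definition inf_conv p G (z : V) : R :=
  inf [set r | exists v a, G v a /\ r = p (z - v) + a].

Lemma sublinear0 p : sublinear p -> p 0 = 0.
Proof. by move=> [_ /(_ 0 0 (lexx 0))]; rewrite scale0r mul0r. Qed.

Section inf_convolution.
Variables (p : V -> R) (G : V -> R -> Prop).
Hypothesis ps : sublinear p.
Hypothesis Gc : convex_cone G.
Hypothesis Gp : forall v a, G v a -> 0 <= p (- v) + a.

(** The compatibility [Gp] keeps the infimum away from minus infinity. *)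
Let lb z v a : G v a -> - p (- z) <= p (z - v) + a.
Proof.
move=> Gva; have := sublinearD ps (z - v) (- z); have := Gp Gva.
by rewrite addrAC subrr add0r; lra.
Qed.

Let hi z : has_inf [set r | exists v a, G v a /\ r = p (z - v) + a].
Proof.
split; first by exists (p (z - 0) + 0), 0, 0; split=> //; exact: cone0.
by exists (- p (- z)) => _ [v [a [Gva ->]]]; exact: lb.
Qed.

Let inf_conv_le z v a : G v a -> inf_conv p G z <= p (z - v) + a.
Proof. by move=> Gva; apply: ge_inf; [case: (hi z)|exists v, a]. Qed.

Let le_inf_conv z r :
  (forall v a, G v a -> r <= p (z - v) + a) -> r <= inf_conv p G z.
Proof.
by move=> h; apply: lb_le_inf => [|_ [v [a [Gva ->]]]]; [case: (hi z)|exact: h].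
Qed.

Let inf_convZ_le a z : 0 < a -> inf_conv p G (a *: z) <= a * inf_conv p G z.
Proof.
move=> a0; rewrite -ler_pdivrMl//; apply: le_inf_conv => v b Gvb.
rewrite ler_pdivrMl// mulrDr -(sublinearZ ps _ (ltW a0)) scalerBr.
by apply: inf_conv_le; exact: coneZ.
Qed.

Lemma inf_conv_sublinear : sublinear (inf_conv p G).
Proof.
split=> [x y|a x].
  rewrite -lerBlDl; apply: le_inf_conv => w b Gwb.
  rewrite lerBlDl [leRHS]addrC -lerBlDl; apply: le_inf_conv => v a Gva.
  rewrite lerBlDl (le_trans (inf_conv_le _ (coneD Gc Gva Gwb)))//.
  have := sublinearD ps (x - v) (y - w); rewrite addrACA -opprD; lra.
rewrite le_eqVlt => /predU1P[<-|a0].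
  rewrite scale0r mul0r; apply/eqP; rewrite eq_le; apply/andP; split.
    by rewrite (le_trans (inf_conv_le _ (cone0 Gc)))// subrr sublinear0// addr0.
  by apply: le_inf_conv => v b Gvb; rewrite sub0r Gp.
(* The reverse inequality is [inf_convZ_le] for [a^-1] at [a *: x]. *)
apply/eqP; rewrite eq_le inf_convZ_le//= -ler_pdivlMl//.
rewrite -[in leLHS](scale1r x) -(mulVf (lt0r_neq0 a0)) -scalerA.
by rewrite inf_convZ_le// invr_gt0.
Qed.

Lemma inf_conv_le_sublinear z : inf_conv p G z <= p z.
Proof. by rewrite (le_trans (inf_conv_le _ (cone0 Gc)))// subr0 addr0. Qed.

Lemma inf_conv_cone v a : G v a -> inf_conv p G v <= a.
Proof.
by move=> /(inf_conv_le v)/le_trans; apply; rewrite subrr sublinear0// add0r.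
Qed.

End inf_convolution.

(** This ray imposes the single constraint [f v <= a]. *)
Lemma cone_ray v (a : R) :
  convex_cone (fun w b => exists2 t, 0 <= t & w = t *: v /\ b = t * a).
Proof.
split=> [|_ _ _ _ [t t0 [-> ->]] [u u0 [-> ->]]|s _ _ s0 [t t0 [-> ->]]].
- by exists 0; rewrite // scale0r mul0r.
- by exists (t + u); rewrite ?addr_ge0// scalerDl mulrDl.
- by exists (s * t); rewrite ?mulr_ge0 ?(ltW s0)// scalerA mulrA.
Qed.

(** Zorn's lemma for the reversed pointwise order: the pointwise infimum of a chain of sublinear
    functionals is sublinear. *)
Lemma minimal_sublinear p : sublinear p -> exists q, [/\ sublinear q,
  forall x, q x <= p x &
  forall r, sublinear r -> (forall x, r x <= q x) -> forall x, q x <= r x].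
Proof.
move=> ps; pose T := {q | sublinear q /\ forall x, q x <= p x}.
pose t0 : T := exist _ p (conj ps (fun=> lexx _)).
pose le (s t : T) := `[< forall x, sval t x <= sval s x >].
have [|r s t /asboolP rs /asboolP st|A Atot|[q [qs qp]] qmin] :=
    @ZL_preorder _ t0 le.
- by move=> t; apply/asboolP => x.
- by apply/asboolP => x; exact: le_trans (st x) (rs x).
- have [[s0 As0]|A0] := pselect (exists s, A s); last first.
    by exists t0 => s As; case: A0; exists s.
  pose B x := [set sval s x | s in A].
  have lbB x : has_inf (B x).
    split; first by exists (sval s0 x), s0.
    exists (- p (- x)) => _ [s _ <-]; case: (svalP s) => ss sp.
    have := sublinearD ss x (- x); rewrite subrr (sublinear0 ss).
    by have := sp (- x); lra.
  have infB x s : A s -> inf (B x) <= sval s x.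
    by move=> As; apply: ge_inf; [case: (lbB x)|exists s].
  have lebB x r : (forall s, A s -> r <= sval s x) -> r <= inf (B x).
    by move=> h; apply: lb_le_inf => [|_ [s As <-]]; [case: (lbB x)|exact: h].
  have sB : sublinear (fun x => inf (B x)).
    have Z a x : 0 < a -> inf (B (a *: x)) <= a * inf (B x).
      move=> a0; rewrite -ler_pdivrMl//; apply: (lebB) => s As.
      by rewrite ler_pdivrMl// -(sublinearZ (svalP s).1 _ (ltW a0)) infB.
    split=> [x y|a x].
      rewrite -lerBlDl; apply: (lebB) => s As.
      rewrite lerBlDl [leRHS]addrC -lerBlDl; apply: (lebB) => t At; rewrite lerBlDl.
      (* The smaller of [s] and [t] serves at both [x] and [y], so subadditivity survives the
         infimum. *)
      have [/asboolP st|/asboolP ts] := Atot _ _ As At.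
        have := sublinearD (svalP t).1 x y; have := infB (x + y) _ At.
        by have := st y; lra.
      have := sublinearD (svalP s).1 x y; have := infB (x + y) _ As.
      by have := ts x; lra.
    rewrite le_eqVlt => /predU1P[<-|a0].
      rewrite scale0r mul0r; apply/eqP; rewrite eq_le; apply/andP; split.
        by rewrite (le_trans (infB _ _ As0))// sublinear0//; case: (svalP s0).
      by apply: (lebB) => s _; rewrite sublinear0//; case: (svalP s).
    apply/eqP; rewrite eq_le Z//= -ler_pdivlMl//.
    rewrite -[in leLHS](scale1r x) -(mulVf (lt0r_neq0 a0)) -scalerA.
    by rewrite Z// invr_gt0.
  have Bp x : inf (B x) <= p x.
    by rewrite (le_trans (infB _ _ As0))//; case: (svalP s0).
  pose tB : T := exist _ (fun x => inf (B x)) (conj sB Bp).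
  by exists tB => s As; apply/asboolP => x; exact: infB.
- exists q; split=> // r rs rq.
  have rp x : r x <= p x by exact: le_trans (rq x) (qp x).
  pose tr : T := exist _ r (conj rs rp).
  by have /asboolP := qmin tr (asboolT rq).
Qed.

(* The infimal convolution of a minimal sublinear functional [q] with the ray
   spanned by [(- v, - q v)] is [q], hence [q (- v) <= - q v]. *)
Lemma hahn_banach p : sublinear p ->
  exists2 f : V -> R^o, linear f & forall x, f x <= p x.
Proof.
move=> /minimal_sublinear[q [qs qp qmin]]; exists q => //.
have qN v : q (- v) = - q v.
  apply/eqP; rewrite eq_le; apply/andP; split; last first.
    by have := sublinearD qs v (- v); rewrite subrr (sublinear0 qs); lra.
  have Gc := cone_ray (- v) (- q v).
  have Gp w b : (exists2 t, 0 <= t & w = t *: - v /\ b = t * - q v) ->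
      0 <= q (- w) + b.
    by move=> [t t0 [-> ->]]; rewrite scalerN opprK sublinearZ// mulrN subrr.
  apply: le_trans (qmin _ (inf_conv_sublinear qs Gc Gp) _ _) _ => [x|].
    exact: inf_conv_le_sublinear.
  by apply: inf_conv_cone => //; exists 1; rewrite // scale1r mul1r.
(* Oddness turns subadditivity at [- x] and [- y] into superadditivity. *)
have qD x y : q (x + y) = q x + q y.
  apply/eqP; rewrite eq_le sublinearD//=.
  by have := sublinearD qs (- x) (- y); rewrite -opprD !qN; lra.
move=> a x y; rewrite qD; congr (_ + _).
have [a0|a0] := leP 0 (a : R); first exact: (sublinearZ qs x a0).
rewrite -[a]opprK scaleNr qN sublinearZ ?oppr_ge0 1?ltW//.
by rewrite -mulNr.
Qed.

Lemma hahn_banach_cone p G : sublinear p -> convex_cone G ->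
  (forall v a, G v a -> 0 <= p (- v) + a) ->
  exists f : V -> R^o, [/\ linear f, forall x, f x <= p x &
    forall v a, G v a -> f v <= a].
Proof.
move=> ps Gc Gp; have [f fl fq] := hahn_banach (inf_conv_sublinear ps Gc Gp).
exists f; split=> // [x|v a Gva].
  exact: le_trans (fq x) (inf_conv_le_sublinear ps Gc Gp x).
exact: le_trans (fq v) (inf_conv_cone ps Gc Gp Gva).
Qed.

End hahn_banach.

(** * Bounded operators and norming functionals *)

Section dual_space.
Variable R : realType.
Implicit Types E F M : completeNormedModType R.

Lemma opnorm_blin_le E F (S : blin E F) k :
  0 <= k -> (forall x, `|S x| <= k * `|x|) -> `|S| <= k.
Proof. by move=> k0 Sk; rewrite blin_normE; exact: opnorm_le. Qed.

Lemma blin_norm_le E F (S : blin E F) x : `|S x| <= `|S| * `|x|.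
Proof. by rewrite blin_normE; exact: opnormP. Qed.

Lemma blinZ E F (S : blin E F) a x : S (a *: x) = a *: S x.
Proof. exact: linearZ. Qed.

Lemma blinD E F (S : blin E F) x y : S (x + y) = S x + S y.
Proof. exact: linearD. Qed.

Lemma blinB E F (S : blin E F) x y : S (x - y) = S x - S y.
Proof. exact: linearB. Qed.

Lemma blin_0 E F (S : blin E F) : S 0 = 0.
Proof. exact: linear0. Qed.

Lemma blin_sum E F (S : blin E F) (J : Type) (r : seq J) (P : pred J) x :
  S (\sum_(j <- r | P j) x j) = \sum_(j <- r | P j) S (x j).
Proof. exact: linear_sum. Qed.

Definition blin_of E F (f : E -> F) k (fl : linear f) (fk : op_bound f k) :
  blin E F := BLin fl (op_bound_continuous fl fk).

Lemma blin_of_norm E F (f : E -> F) k (fl : linear f) (fk : op_bound f k) :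
  `|blin_of fl fk| <= k.
Proof. by case: (fk) => k0 fk'; exact: opnorm_blin_le. Qed.

Section composition.
Variables (E F M : completeNormedModType R) (S : blin F M) (T : blin E F).

Let comp_linear : linear (S \o T).
Proof. by move=> a x y /=; rewrite !blin_linear. Qed.

Let comp_bound : op_bound (S \o T) (`|S| * `|T|).
Proof.
split=> [|x]; first exact: mulr_ge0.
by rewrite (le_trans (blin_norm_le _ _))// -mulrA ler_wpM2l// blin_norm_le.
Qed.

Definition blin_comp : blin E M := blin_of comp_linear comp_bound.

Lemma blin_comp_norm : `|blin_comp| <= `|S| * `|T|.
Proof. exact: blin_of_norm. Qed.

End composition.

(** Hahn-Banach below the norm; the ray through [- u] forces the value at [u] to be at least the
    norm of [u]. *)
Lemma norming_functional M (u : M) :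
  exists2 f : dual M, `|f| <= 1 & f u = `|u|.
Proof.
have ns : @sublinear R M Num.norm.
  by split=> [x y|a x a0]; [exact: ler_normD|rewrite normrZ ger0_norm].
have Gp v (a : R) : (exists2 t, 0 <= t & v = t *: - u /\ a = t * - `|u|) ->
    0 <= `|- v| + a.
  move=> [t t0 [-> ->]].
  by rewrite scalerN opprK normrZ ger0_norm// mulrN subrr.
have [f [fl fn fG]] := hahn_banach_cone ns (cone_ray (- u) (- `|u|)) Gp.
have fN x : f (- x) = - f x.
  by have := fl (-1) x 0; rewrite addr0 scaleN1r=> ->; have := fl (-1) 0 0;
    rewrite scaler0 addr0 !scaleN1r; lra.
have fb : op_bound (f : M -> R^o) 1.
  split=> // x; rewrite mul1r ler_norml fn andbT.
  by have := fn (- x); rewrite fN normrN; lra.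
exists (blin_of fl fb); first exact: blin_of_norm.
apply/eqP; rewrite eq_le fn/=.
have /fG : exists2 t : R, 0 <= t & - u = t *: - u /\ - `|u| = t * - `|u|.
  by exists 1; rewrite // scale1r mul1r.
by rewrite fN lerN2.
Qed.

End dual_space.

(** * Finite-dimensional quotients *)

Section quotients.
Variables (R : realType) (E : completeNormedModType R).

Section quotient_blin.
Variable L : closedSubspace E.

Lemma quotient_map_linear : linear (@quotient_map R E L).
Proof. exact: spi_linear. Qed.

Lemma quotient_map_bound : op_bound (@quotient_map R E L) 1.
Proof.
split=> // x; rewrite mul1r norm_quotient_map -[in leRHS](addr0 x).
exact: (dist_to_le x (cs0 L)).
Qed.

Definition quotient_blin : blin E (quotient_space L) :=
  blin_of quotient_map_linear quotient_map_bound.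

Lemma quotient_blinE x : quotient_blin x = quotient_map L x.
Proof. by []. Qed.

Lemma quotient_blin_norm : `|quotient_blin| <= 1.
Proof. exact: blin_of_norm. Qed.

Lemma quotient_map_surj (z : quotient_space L) : exists x, quotient_map L x = z.
Proof. by exists (srepr z); exact: sreprK. Qed.

End quotient_blin.

End quotients.

Section frames.
Variables (R : realType) (M : completeNormedModType R).
Implicit Types (s : seq (dual M * M)).

(** The list [s] represents a tensor in the product of the dual and [M]; this is its finite-rank
    operator. *)
Definition frame_op s (x : M) : M := \sum_(a <- s) a.1 x *: a.2.

Lemma frame_op_linear s : linear (frame_op s).
Proof.
move=> a x y; rewrite /frame_op scaler_sumr -big_split; apply: eq_bigr => b _ /=.
by rewrite blin_linear scalerDl scalerA.
Qed.

Lemma frame_op_bound s : op_bound (frame_op s) (\sum_(a <- s) `|a.1| * `|a.2|).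
Proof.
split=> [|x]; first by apply: sumr_ge0 => a _; rewrite mulr_ge0.
rewrite mulr_suml (le_trans (ler_norm_sum _ _ _))//; apply: ler_sum => a _.
by rewrite normrZ mulrAC ler_wpM2r// blin_norm_le.
Qed.

Definition frame_blin s := blin_of (@frame_op_linear s) (frame_op_bound s).

(* Adjoins [v] to the range of a finite-rank projection [p], using a functional
   that is [1] at [v - p v]. *)
Lemma finite_rank_projection (vs : seq M) : exists s,
  (forall x, frame_op s (frame_op s x) = frame_op s x) /\
  forall v, v \in vs -> frame_op s v = v.
Proof.
elim: vs => [|v vs [s [pp pvs]]].
  by exists [::]; split=> // x; rewrite /frame_op !big_nil.
pose p := frame_blin s; pose u := v - p v.
have [u0|u0] := eqVneq u 0.
  exists s; split=> // w; rewrite inE => /predU1P[->|/pvs//].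
  by apply/eqP; rewrite eq_sym -subr_eq0; apply/eqP.
have [f _ fu] := norming_functional u.
pose f1 : dual M := `|u|^-1 *: f.
have f1u : f1 u = 1.
  by rewrite blin_scaleE fu; apply: mulVf; rewrite normr_eq0.
(* Precomposing with [1 - p] makes the new functional vanish on the range of [p], so that adding the
   new term keeps the operator idempotent. *)
have gl : linear (fun x => f1 (x - p x) : R^o).
  move=> a x y; rewrite -blin_linear; congr (f1 _).
  by rewrite blin_linear scalerBr opprD addrACA.
have gb : op_bound (fun x => f1 (x - p x) : R^o) (`|f1| * (1 + `|p|)).
  split=> [|x]; first by rewrite mulr_ge0 ?addr_ge0.
  rewrite (le_trans (blin_norm_le _ _))// -mulrA ler_wpM2l//.
  by rewrite (le_trans (ler_normB _ _))// mulrDl mul1r lerD2l blin_norm_le.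
pose g : dual M := blin_of gl gb.
have p'E x : frame_op ((g, u) :: s) x = f1 (x - p x) *: u + p x.
  by rewrite /frame_op big_cons.
have pu : p u = 0.
  by rewrite /u blinB; apply/eqP; rewrite subr_eq0 eq_sym; apply/eqP/pp.
exists ((g, u) :: s); split=> [x|w].
  have pp' : p (f1 (x - p x) *: u + p x) = p x.
    by rewrite blin_linear pu scaler0 add0r; exact: pp.
  have f1Z (a : R) : f1 (a *: u) = a by rewrite blinZ f1u [LHS]mulr1.
  by rewrite !p'E pp' addrK f1Z.
rewrite inE p'E => /predU1P[->|/pvs pw]; first by rewrite -/u f1u scale1r subrK.
by rewrite [p w]pw subrr blin_0 scale0r add0r.
Qed.

(** A finite-rank projection that fixes a spanning family is the identity, and its tensor supplies
    continuous coordinates. *)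
Lemma finite_frame n (v : 'I_n -> M) :
  (forall x, exists c : 'I_n -> R, x = \sum_i c i *: v i) ->
  exists m (e : 'I_m -> M) (phi : 'I_m -> dual M),
    forall x, x = \sum_j phi j x *: e j.
Proof.
move=> span; have [s [_ sv]] := finite_rank_projection [seq v i | i : 'I_n].
exists (size s), (fun j => (tnth (in_tuple s) j).2),
  (fun j => (tnth (in_tuple s) j).1) => x.
have <- : frame_op s x = \sum_(j < size s)
    (tnth (in_tuple s) j).1 x *: (tnth (in_tuple s) j).2.
  by rewrite /frame_op big_tnth.
have [c ->] := span x.
rewrite -[frame_op s]/(blin_fun (frame_blin s)) blin_sum.
apply: eq_bigr => i _; rewrite blinZ [frame_blin s _]sv//.
by apply: map_f; rewrite mem_enum.
Qed.

End frames.

Lemma quotient_frame (R : realType) (E : completeNormedModType R)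
    (L : finCodimSubspace E) :
  exists m (e : 'I_m -> quotient_space L) (phi : 'I_m -> dual (quotient_space L)),
    forall x, x = \sum_j phi j x *: e j.
Proof.
have [n [v vL]] := fc_codim L.
apply: (@finite_frame _ _ n (fun i => quotient_map L (v i))) => z.
have [x <-] := quotient_map_surj z; have [c xc] := vL x; exists c.
rewrite -quotient_blinE.
under eq_bigr do rewrite -quotient_blinE -blinZ.
by rewrite -blin_sum; exact/quotient_mapP.
Qed.

Section norming_family.
Variables (R : realType) (M : completeNormedModType R) (m : nat).
Variables (e : 'I_m -> M) (phi : 'I_m -> dual M).
Hypothesis frame : forall x, x = \sum_j phi j x *: e j.

(** A finite grid in coordinates replaces compactness of the unit sphere: every unit vector is close
    to a grid point, whose norming functional is then almost norming for it. *)
Lemma norming_family (d : R) : 0 < d ->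
  exists (Lam : finType) (nu : Lam -> dual M), (forall l, `|nu l| <= 1) /\
    forall x C, (forall l, `|nu l x| <= C) -> `|x| <= (1 + d) * C.
Proof.
move=> d0; pose c := \sum_j `|e j|; pose K := \sum_j `|phi j|.
have c0 : 0 <= c by exact: sumr_ge0.
have K0 : 0 <= K by exact: sumr_ge0.
have phiK j : `|phi j| <= K.
  by rewrite /K (bigD1 j)//= lerDl; exact: sumr_ge0.
(* The mesh is chosen for [etac]; the summand 1 in [c + 1] guards against [c = 0]. *)
pose eta := d / (2 * (1 + d) * (c + 1)).
have eta0 : 0 < eta by rewrite divr_gt0// !mulr_gt0//; lra.
have etac : (1 + d) * (2 * (eta * c)) <= d.
  have -> : (1 + d) * (2 * (eta * c)) = d * (c / (c + 1)).
    by rewrite /eta; field; apply/andP; split; lra.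
  by rewrite ger_pMr// ler_pdivrMr ?ltr_wpDl// mul1r lerDl.
(* Coordinates of unit vectors lie in an interval of length [2 * K]; [N] grid values of mesh [eta]
   cover it. *)
pose N := (Num.truncn (2 * K / eta)).+1.
pose grid (g : {ffun 'I_m -> 'I_N}) := \sum_j (eta * (g j)%:R - K) *: e j.
have /choice[nu nuP] : forall g, exists f : dual M,
    `|f| <= 1 /\ f (grid g) = `|grid g|.
  by move=> g; have [f f1 fg] := norming_functional (grid g); exists f.
exists {ffun 'I_m -> 'I_N}, nu; split=> [g|x C nuC]; first by case: (nuP g).
(* The index type is inhabited because [N] is a successor. *)
have C0 : 0 <= C by exact: le_trans (nuC [ffun=> ord0]).
have [->|x0] := eqVneq x 0.
  by rewrite normr0 mulr_ge0// addr_ge0// ltW.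
have nx0 : 0 < `|x| by rewrite normr_gt0.
pose u := `|x|^-1 *: x.
have u1 : `|u| = 1 by rewrite normrZ ger0_norm ?invr_ge0// mulVf ?lt0r_neq0.
pose t j := (phi j u + K) / eta.
have phiu j : `|phi j u| <= K.
  by rewrite (le_trans (blin_norm_le _ _))// u1 mulr1.
have t0 j : 0 <= t j.
  by rewrite divr_ge0 ?(ltW eta0)//; have := phiu j; rewrite ler_norml; lra.
have tN j : (Num.truncn (t j) < N)%N.
  rewrite ltnS le_truncn// ler_wpM2r ?invr_ge0 ?(ltW eta0)//.
  by have := phiu j; rewrite ler_norml; lra.
pose g := [ffun j => Ordinal (tN j)].
have ug : `|u - grid g| <= eta * c.
  rewrite {1}[u]frame /grid -sumrB mulr_sumr (le_trans (ler_norm_sum _ _ _))//.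
  apply: ler_sum => j _; rewrite -scalerBl normrZ ler_wpM2r// ffunE /=.
  have /andP[] := Num.Theory.truncn_itv (t0 j).
  rewrite -natr1 ler_pdivlMr// ltr_pdivrMr// mulrDl mul1r mulrC ler_norml.
  by lra.
have [ng nug] := nuP g.
have nub (y : M) : `|nu g y| <= `|y|.
  by rewrite (le_trans (blin_norm_le _ _))// ler_piMl.
(* One error [eta * c] comes from the norm of the grid point, the other from moving the functional
   from it to [u]. *)
have h1 : 1 - 2 * (eta * c) <= nu g u.
  have := nub (grid g - u); rewrite distrC blinB nug ler_norml => /andP[_].
  have := ler_normD (u - grid g) (grid g); rewrite subrK u1; lra.
have h2 : nu g u <= `|x|^-1 * C.
  rewrite blinZ ler_wpM2l ?invr_ge0//.
  exact: le_trans (ler_norm _) (nuC g).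
have := le_trans h1 h2; rewrite ler_pdivlMl// => h3.
have d1 : 0 < 1 + d by rewrite addr_gt0.
have := ler_wpM2l (ltW d1) h3; apply: le_trans.
rewrite mulrCA ler_peMr// mulrBr; lra.
Qed.

End norming_family.

(** * Ideals and their hulls *)

Section bidual.
Variables (R : realType) (E : completeNormedModType R).

Lemma canon_incl_linear : linear (@canon_incl R E).
Proof.
move=> a x y; apply: blinP => f; rewrite blin_addE blin_scaleE.
exact: blin_linear.
Qed.

Lemma canon_incl_bound : op_bound (@canon_incl R E) 1.
Proof.
split=> // x; rewrite mul1r; apply: opnorm_blin_le => // f.
by rewrite canon_inclE mulrC; exact: (@blin_norm_le R E R^o).
Qed.

Definition canon_blin : blin E (bidual E) :=
  blin_of canon_incl_linear canon_incl_bound.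

Lemma canon_blin_norm : `|canon_blin| <= 1. Proof. exact: blin_of_norm. Qed.

(* This is the composition of the bitranspose of the quotient map with the
   inverse of the canonical inclusion of the finite-dimensional [E / L]. *)
Lemma quotient_map_bidual (L : finCodimSubspace E) :
  exists2 S : blin (bidual E) (quotient_space L), `|S| <= 1 &
    forall x, S (canon_incl x) = quotient_map L x.
Proof.
have [m [e [phi frame]]] := quotient_frame L.
pose q := quotient_blin L.
pose S0 (xi : bidual E) := \sum_j xi (blin_comp (phi j) q) *: e j.
have Sl : linear S0.
  move=> a xi ze; rewrite /S0 scaler_sumr -big_split; apply: eq_bigr => j _.
  by rewrite blin_addE blin_scaleE scalerDl scalerA.
have Sb : op_bound S0 1.
  split=> // xi; rewrite mul1r.
  (* The norm is tested by [psi]: the value [psi (S0 xi)] is [xi] at the composition of [psi] and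
     [q], a functional of norm at most 1. *)
  have [psi psi1 <-] := norming_functional (S0 xi).
  have -> : psi (S0 xi) = xi (blin_comp psi q).
    transitivity (xi (\sum_j psi (e j) *: blin_comp (phi j) q)).
      rewrite !blin_sum; apply: eq_bigr => j _.
      by rewrite !blinZ; exact: mulrC.
    congr (xi _); apply: blinP => x.
    rewrite [RHS]/= [quotient_map _ _]frame blin_sum.
    have -> : forall s (F : 'I_m -> dual E),
        (\sum_(j <- s) F j) x = \sum_(j <- s) F j x.
      move=> s F; elim: s => [|j s IH]; first by rewrite !big_nil.
      by rewrite !big_cons blin_addE IH.
    apply: eq_bigr => j _; rewrite blin_scaleE blinZ; exact: mulrC.
  rewrite (le_trans (ler_norm _))// (le_trans (blin_norm_le _ _))//.
  rewrite ler_piMr// (le_trans (blin_comp_norm _ _))// mulr_ile1//.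
  exact: quotient_blin_norm.
exists (blin_of Sl Sb); first exact: blin_of_norm.
by move=> x; rewrite [RHS]frame.
Qed.

End bidual.

Section lipschitz_maps.
Variable R : realType.
Implicit Types X Y : pmetricType R.

Lemma Lip_ge0 X Y (f : X -> Y) : Lip0 f -> 0 <= Lip f.
Proof. by move=> [_ fk]; apply: lb_le_inf => // k []. Qed.

Lemma Lip_le X Y (f : X -> Y) k : lip_bound f k -> Lip f <= k.
Proof. by move=> fk; apply: ge_inf => //; exists 0 => ? []. Qed.

Lemma lip_bound_Lip X Y (f : X -> Y) : Lip0 f -> lip_bound f (Lip f).
Proof.
move=> f0; split=> [|x y]; first exact: Lip_ge0.
have [->|xy] := eqVneq x y; first by rewrite !mdistxx mulr0.
rewrite -ler_pdivrMr ?mdist_gt0//; apply: lb_le_inf; first by case: f0.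
by move=> k [_ fk]; rewrite ler_pdivrMr ?mdist_gt0.
Qed.

Lemma lip_bound_id X : lip_bound (@id X) 1.
Proof. by split=> // x y; rewrite mul1r. Qed.

Lemma lip_bound_incl X (X0 : finPSubset X) : lip_bound (@incl R X X0) 1.
Proof. by split=> // x y; rewrite mul1r mdist_set_type. Qed.

End lipschitz_maps.

Section ideals.
Variables (R : realType) (I : lip_class R).
Hypothesis HI : banach_lip_ideal I.
Implicit Types (X Y : pmetricType R) (E F : completeNormedModType R).

Lemma ideal_lip_bound X E (f : X -> E) :
  lc_mem I f -> @lip_bound R X (pmetric_of E) f (lc_norm I f).
Proof.
move=> If; have f0 := bli_Lip0 HI If; have [L0 fL] := lip_bound_Lip f0.
have fI := bli_Lip_le HI If; split=> [|x y]; first exact: le_trans L0 fI.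
by rewrite (le_trans (fL x y))// ler_wpM2r// mdist_ge0.
Qed.

Lemma ideal_norm_ge0 X E (f : X -> E) : lc_mem I f -> 0 <= lc_norm I f.
Proof. by move=> /ideal_lip_bound[]. Qed.

Lemma ideal_comp X Y E F (g : Y -> X) (f : X -> E) (S : blin E F) a b :
  g (pm_base Y) = pm_base X -> lip_bound g b -> `|S| <= a -> lc_mem I f ->
  lc_mem I (S \o f \o g) /\ lc_norm I (S \o f \o g) <= a * lc_norm I f * b.
Proof.
move=> g0 gb Sa If; have Lg : Lip0 g by split=> //; exists b.
split; first exact: (bli_comp HI).
have n0 := ideal_norm_ge0 If.
rewrite (le_trans (bli_norm_comp HI S Lg If))// ler_pM ?mulr_ge0 ?Lip_ge0//.
  by rewrite ler_wpM2r.
exact: Lip_le.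
Qed.

Lemma ideal_comp_blin X E F (f : X -> E) (S : blin E F) a :
  `|S| <= a -> lc_mem I f ->
  lc_mem I (S \o f) /\ lc_norm I (S \o f) <= a * lc_norm I f.
Proof.
move=> Sa If.
have [] := @ideal_comp X X E F id f S a 1 erefl (@lip_bound_id R X) Sa If.
by rewrite mulr1.
Qed.

Let enorm_le X E (f : X -> E) (X0 : finPSubset X) (L : finCodimSubspace E) :
  (lc_enorm I (quotient_map L \o f \o @incl R X X0) <= max_norm I f)%E.
Proof. by apply: ereal_sup_ubound; exists (X0, L). Qed.

Let enorm_ge0 X E (f : X -> E) : (0 <= lc_enorm I f)%E.
Proof.
by rewrite /lc_enorm; case: asboolP => // If; rewrite lee_fin ideal_norm_ge0.
Qed.

Definition base_subset X : finPSubset X :=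
  FinPSubset (finite_set1 (pm_base X)) erefl.

Lemma whole_codim E : exists n (v : 'I_n -> E), forall x, exists c : 'I_n -> R,
  [set: E] (x - \sum_i c i *: v i).
Proof. by exists 0%N, (fun=> 0) => x; exists (fun=> 0). Qed.

Definition whole_space E : finCodimSubspace E :=
  @FinCodimSubspace R E
    (@ClosedSubspace R E setT Logic.I (fun _ _ _ _ _ => Logic.I) closedT)
    (@whole_codim E).

(** The supremum runs over a nonempty family, so below [+oo] it is a real number and [fine] loses
    nothing. *)
Let max_norm_ge0 X E (f : X -> E) : (0 <= max_norm I f)%E.
Proof.
exact: le_trans (enorm_ge0 _) (enorm_le f (base_subset X) (whole_space E)).
Qed.

Lemma max_hull_mem X E (f : X -> E) c : @Lip0 R X (pmetric_of E) f ->
  (forall (X0 : finPSubset X) (L : finCodimSubspace E),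
    lc_mem I (quotient_map L \o f \o @incl R X X0) /\
    lc_norm I (quotient_map L \o f \o @incl R X X0) <= c) ->
  lc_mem (max_hull I) f /\ lc_norm (max_hull I) f <= c.
Proof.
move=> f0 fc; have : (max_norm I f <= c%:E)%E.
  apply: ge_ereal_sup => _ [[X0 L] _ <-] /=; have [Iq qc] := fc X0 L.
  by rewrite /lc_enorm asboolT// lee_fin.
rewrite /max_hull/=; have := max_norm_ge0 f.
by case: (max_norm I f) => [r|//|//] r0 rc; split=> //; rewrite ltry.
Qed.

Lemma max_hull_quotient X E (f : X -> E) (X0 : finPSubset X)
    (L : finCodimSubspace E) : lc_mem (max_hull I) f ->
  lc_mem I (quotient_map L \o f \o @incl R X X0) /\
  lc_norm I (quotient_map L \o f \o @incl R X X0) <= lc_norm (max_hull I) f.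
Proof.
rewrite /max_hull/= => -[_]; have := enorm_le f X0 L; have := max_norm_ge0 f.
case: (max_norm I f) => [r _|//|//]; rewrite /lc_enorm.
by case: asboolP => // Iq; rewrite lee_fin.
Qed.

Lemma ideal_max_hull X E (f : X -> E) : lc_mem I f ->
  lc_mem (max_hull I) f /\ lc_norm (max_hull I) f <= lc_norm I f.
Proof.
move=> If; apply: max_hull_mem => [|X0 L]; first exact: (bli_Lip0 HI If).
have [] := @ideal_comp _ _ _ _ (@incl R X X0) f (quotient_blin L) 1 1 erefl
  (lip_bound_incl X0) (quotient_blin_norm L) If.
by rewrite mul1r mulr1.
Qed.

(** Inclusions and quotient maps are contractive, so [ideal_max_hull] gives one half of the equality
    and only the other has to be checked. *)
Lemma maximalP : maximal I <->
  forall X E (f : X -> E), lc_mem (max_hull I) f ->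
    lc_mem I f /\ lc_norm I f <= lc_norm (max_hull I) f.
Proof.
split=> [Imax X E f Mf|h X E f].
  have [[_ MI] IM] := Imax X E f; have If := MI Mf.
  by rewrite (IM If) lexx.
split; first by split=> [/ideal_max_hull[]|/h[]].
move=> If; have [Mf MI] := ideal_max_hull If; have [_ IM] := h _ _ _ Mf.
by apply/eqP; rewrite eq_le IM MI.
Qed.

(** Again one half is automatic, as the canonical inclusion has norm at most 1. *)
Lemma regularP : regular I <->
  forall X E (f : X -> E), @Lip0 R X (pmetric_of E) f ->
    lc_mem I (@canon_incl R E \o f) ->
    lc_mem I f /\ lc_norm I f <= lc_norm I (@canon_incl R E \o f).
Proof.
split=> [Ireg X E f f0 Jf|h X E f].
  have [[_ MI] IM] := Ireg X E f; have If : lc_mem I f by exact: MI.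
  by split=> //; rewrite (IM If).
have JI : lc_mem I f -> lc_mem I (@canon_incl R E \o f) /\
    lc_norm I (@canon_incl R E \o f) <= lc_norm I f.
  move=> /(ideal_comp_blin (canon_blin_norm E)); rewrite mul1r; exact.
split; first split=> [If|[f0 Jf]].
- by split; [exact: (bli_Lip0 HI If)|case: (JI If)].
- by case: (h _ _ _ f0 Jf).
- move=> If; have [Jf JfI] := JI If.
  have [_ IJ] := h _ _ _ (bli_Lip0 HI If) Jf.
  by apply/eqP; rewrite eq_le IJ JfI.
Qed.

(** By [quotient_map_bidual] every local piece of [f] is a contraction applied to a restriction of
    the bidual-valued map. *)
Lemma maximal_regular : maximal I -> regular I.
Proof.
move=> /maximalP Imax; apply/regularP => X E f f0 Jf.
have [|Mf fJ] := @max_hull_mem X E f (lc_norm I (@canon_incl R E \o f)) f0.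
  move=> X0 L; have [S S1 SJ] := quotient_map_bidual L.
  have [] := @ideal_comp _ _ _ _ (@incl R X X0) (@canon_incl R E \o f) S 1 1 erefl
    (lip_bound_incl X0) S1 Jf.
  rewrite mul1r mulr1; suff -> : quotient_map L \o f \o @incl R X X0 =
    S \o (@canon_incl R E \o f) \o @incl R X X0 by [].
  by apply/funext => x /=; rewrite SJ.
by have [If fM] := Imax _ _ _ Mf; split=> //; exact: le_trans fM fJ.
Qed.

End ideals.

(** * Maps in the maximal hull as ultraproducts of their local pieces *)

Section ultrafilter_limits.
Variables (R : realType) (T : Type) (U : ultrafilter T).
Implicit Types (u v : T -> R).

Lemma ultra_lim_near u v (l : R) : u @ uf_set U --> l ->
  uf_set U [set i | u i = v i] -> v @ uf_set U --> l.
Proof. by move=> ul uv; apply: cvg_trans ul; exact: near_eq_cvg. Qed.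

Lemma ultra_lim_eq u (l : R) :
  uf_set U [set i | u i = l] -> lim (u @ uf_set U) = l.
Proof.
move=> ul; apply: cvg_lim => //; apply: (@ultra_lim_near (fun=> l)).
  exact: cvg_cst.
by apply: filterS ul => i.
Qed.

End ultrafilter_limits.

Section factorization.
Variables (R : realType) (E : completeNormedModType R).
Implicit Types (L : closedSubspace E) (phi : dual E).

Definition vanishes_on L phi := forall x, cs_set L x -> phi x = 0.

(* The functional induced by [phi] on the quotient by [L], or [0] if there is
   none. *)
Definition factor_fun L phi (z : quotient_space L) : R^o :=
  if `[< vanishes_on L phi >] then phi (srepr z) else 0.

Lemma factor_quotient L phi x :
  vanishes_on L phi -> factor_fun phi (quotient_map L x) = phi x.
Proof.
move=> Lphi; rewrite /factor_fun asboolT//; apply/eqP.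
rewrite -subr_eq0 -blinB Lphi//; apply/quotient_mapP.
exact: sreprK.
Qed.

Lemma factor_linear L phi : linear (@factor_fun L phi).
Proof.
have [Lphi|nL] := pselect (vanishes_on L phi); last first.
  by move=> a x y; rewrite /factor_fun asboolF// scaler0 addr0.
move=> a y z; have [x <-] := quotient_map_surj y.
have [x' <-] := quotient_map_surj z.
by rewrite -quotient_map_linear !factor_quotient// blin_linear.
Qed.

Lemma factor_bound L phi : op_bound (@factor_fun L phi) `|phi|.
Proof.
split=> // z; have [Lphi|nL] := pselect (vanishes_on L phi); last first.
  by rewrite /factor_fun asboolF// normr0 mulr_ge0.
have [x <-] := quotient_map_surj z; rewrite factor_quotient//.
have [->|phi0] := eqVneq phi 0; first by rewrite !normr0 mul0r.
rewrite -ler_pdivrMl ?normr_gt0// norm_quotient_map.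
apply: lb_le_inf => [|_ [l Ll <-]].
  by exists `|x + 0|, 0 => //; exact: cs0.
rewrite ler_pdivrMl ?normr_gt0// -[phi x]addr0 -(Lphi l Ll) -blinD.
exact: blin_norm_le.
Qed.

Definition factor L phi : dual (quotient_space L) :=
  blin_of (@factor_linear L phi) (@factor_bound L phi).

Lemma factorE L phi x :
  vanishes_on L phi -> factor L phi (quotient_map L x) = phi x.
Proof. exact: factor_quotient. Qed.

Lemma factor_norm L phi : `|factor L phi| <= `|phi|.
Proof. exact: blin_of_norm. Qed.

Lemma factorZD L phi psi a z : vanishes_on L phi -> vanishes_on L psi ->
  factor L (a *: phi + psi) z = a *: factor L phi z + factor L psi z.
Proof.
move=> Lphi Lpsi; have [x <-] := quotient_map_surj z.
rewrite !factorE// ?blin_addE ?blin_scaleE// => l Ll.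
by rewrite blin_addE blin_scaleE Lphi// Lpsi// scaler0 addr0.
Qed.

(** Intersecting with a kernel raises the codimension by at most one: if [phi] does not vanish on
    [L], some [w] in [L] off the kernel is added to the spanning family. *)
Lemma finCodim_ker (L : finCodimSubspace E) phi :
  exists K : finCodimSubspace E, forall x, cs_set K x <-> cs_set L x /\ phi x = 0.
Proof.
pose K := [set x | cs_set L x /\ phi x = 0].
have K0 : K 0 by split; [exact: cs0|exact: blin_0].
have KZD a x y : K x -> K y -> K (a *: x + y).
  move=> [Lx phix] [Ly phiy]; split; first exact: csZD.
  by rewrite blin_linear phix phiy scaler0 addr0.
have Kc : closed K.
  apply: (@closedI _ L (phi @^-1` [set 0])); first exact: cs_closed.
  by apply: closed_comp => [x _|]; [exact: blin_continuous|exact: closed_eq].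
have Kfc : exists n (v : 'I_n -> E), forall x, exists c : 'I_n -> R,
    K (x - \sum_i c i *: v i).
  have [n [v vL]] := fc_codim L.
  have [Lphi|/existsNP[w /not_implyP[Lw /eqP phiw]]] :=
      pselect (vanishes_on L phi).
    exists n, v => x; have [c xc] := vL x; exists c; split=> //; exact: Lphi.
  exists n.+1, (fun i => if unlift ord0 i is Some j then v j else w) => x.
  have [c xc] := vL x; pose y := x - \sum_i c i *: v i.
  exists (fun i => if unlift ord0 i is Some j then c j else phi y / phi w).
  rewrite big_ord_recl/= unlift_none.
  under eq_bigr do rewrite liftK.
  rewrite opprD addrCA addrC -/y; split.
    by rewrite -scaleNr addrC; exact: csZD.
  by rewrite blinB blinZ; apply/eqP; rewrite subr_eq0 eq_sym; apply/eqP/divfK.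
exists (FinCodimSubspace (fc_subspace := ClosedSubspace K0 KZD Kc) Kfc).
by move=> x; split.
Qed.

End factorization.

Section max_hull_of_ultrastable.
Variables (R : realType) (X : pmetricType R) (E : completeNormedModType R).

Definition cofinal_index : Type := (finPSubset X * finCodimSubspace E)%type.

(** The conditions given by finitely many points and functionals form a filter base; common kernels
    of finitely many functionals have finite codimension. *)
Lemma cofinal_ultrafilter : exists U : ultrafilter cofinal_index,
  (forall x : X, uf_set U [set p | fps_set p.1 x]) /\
  (forall phi : dual E, uf_set U [set p : cofinal_index | vanishes_on p.2 phi]).
Proof.
pose B (s : seq X * seq (dual E)) := [set p : cofinal_index |
  (forall x, x \in s.1 -> fps_set p.1 x) /\
  (forall phi, phi \in s.2 -> vanishes_on p.2 phi)].
have FB : ProperFilter (filter_from setT B).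
  apply: filter_from_proper; [apply: filter_from_filter|].
  - by exists ([::], [::]).
  - move=> [xs fs] [ys gs] _ _; exists (xs ++ ys, fs ++ gs) => // p [/= px pf].
    by split; split=> /= z zs; (apply: px || apply: pf); rewrite mem_cat zs// orbT.
  - move=> [xs fs] _.
    have [L Lfs] : exists L : finCodimSubspace E,
        forall phi, phi \in fs -> vanishes_on L phi.
      elim: fs => [|phi fs [L Lfs]]; first by exists (whole_space E).
      have [K KL] := finCodim_ker L phi; exists K => psi.
      rewrite inE => /predU1P[->|/Lfs psiL] x /KL[]//.
      by move=> /psiL.
    have fin : finite_set [set` pm_base X :: xs] by exact: finite_seq.
    have base : [set` pm_base X :: xs] (pm_base X) by rewrite /= mem_head.
    exists (FinPSubset fin base, L); split=> //= x xxs.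
    by rewrite inE xxs orbT.
have [G [GU BG]] := ultraFilterLemma FB.
exists (Ultrafilter GU); split=> [x|phi] /=; apply: BG.
  by exists ([:: x], [::]) => // p [/= + _]; apply; rewrite inE.
by exists ([::], [:: phi]) => // p [/= _]; apply; rewrite inE.
Qed.

Variable U : ultrafilter cofinal_index.
Hypothesis UX : forall x : X, uf_set U [set p | fps_set p.1 x].
Hypothesis UE : forall phi : dual E,
  uf_set U [set p : cofinal_index | vanishes_on p.2 phi].

(** The default, the base point, keeps the family bounded; by [UX] it does not affect limits along
    [U]. *)
Definition retract (x : X) (p : cofinal_index) : pmetric_sub p.1 :=
  insubd (pm_base (pmetric_sub p.1)) x.

Lemma retractE x p : fps_set p.1 x -> incl (retract x p) = x.
Proof. by move=> px; apply: insubdK; exact: mem_set. Qed.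

Lemma retract_bounded x : exists M : R, forall p,
  mdist (retract x p) (pm_base (pmetric_sub p.1)) <= M.
Proof.
exists (mdist x (pm_base X)) => p; have [px|px] := pselect (fps_set p.1 x).
  by rewrite mdist_set_type -[set_val _]/(incl (retract x p)) retractE.
rewrite /retract /insubd insubN ?mdistxx ?mdist_ge0//.
by apply/negP => /set_mem.
Qed.

Definition embed (x : X) : ultralimit U (fun p => pmetric_sub p.1) :=
  pclass U (BPFam (retract_bounded x)).

Lemma embed_base : embed (pm_base X) = pm_base (ultralimit U _).
Proof.
apply/pclassP; apply: ultra_lim_eq; apply: filterS (UX (pm_base X)) => p px /=.
by rewrite mdist_set_type -[set_val _]/(incl (retract _ p)) retractE// mdistxx.
Qed.

Lemma embed_lip_bound : lip_bound embed 1.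
Proof.
split=> // x y; rewrite mul1r [leLHS]mdist_pclass.
rewrite (ultra_lim_eq (l := mdist x y))//.
apply: filterS (filterI (UX x) (UX y)) => p [px py] /=.
rewrite mdist_set_type -[set_val (retract x p)]/(incl (retract x p)).
by rewrite -[set_val _]/(incl (retract y p)) !retractE.
Qed.

Local Notation Q := (fun p : cofinal_index => quotient_space p.2).

Definition ulim_factor (b : bfam Q) (phi : dual E) : R^o :=
  lim ((fun p : cofinal_index => factor p.2 phi (b p)) @ uf_set U).

Lemma ulim_factorP (b : bfam Q) phi :
  (fun p : cofinal_index => factor p.2 phi (b p)) @ uf_set U -->
  ulim_factor b phi.
Proof.
have [M bM] := bf_bounded b; apply: (@ultra_cvg _ _ _ _ (`|phi| * M)) => p.
rewrite (le_trans (blin_norm_le _ _))// ler_pM//; exact: factor_norm.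
Qed.

(** At a fixed index [factor] is additive in the functional only if both vanish on the subspace; by
    [UE] this holds on a set of [U]. *)
Lemma ulim_factor_linear b : linear (ulim_factor b).
Proof.
move=> a phi psi; apply: cvg_lim => //.
apply: (ultra_lim_near (u := fun p : cofinal_index =>
  a * factor p.2 phi (b p) + factor p.2 psi (b p))).
  by apply: cvgD; [apply: cvgM; [exact: cvg_cst|]|]; exact: ulim_factorP.
apply: filterS (filterI (UE phi) (UE psi)) => p [pphi ppsi].
by apply/esym; exact: factorZD.
Qed.

Lemma ulim_factor_bound b : op_bound (ulim_factor b) (ulim_norm U b).
Proof.
have b0 : 0 <= ulim_norm U b.
  by have := normr_ge0 (uclass U b); rewrite norm_uclass.
split=> // phi; rewrite mulrC.
apply: (ultra_cvg_le (cvg_norm (@ulim_factorP b phi))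
  (cvgM (cvg_cst `|phi|) (@ulim_normP _ _ U _ b))).
apply: nearW => p; apply: le_trans (blin_norm_le _ _) _.
by rewrite ler_wpM2r// factor_norm.
Qed.

Definition ulim_factor_blin b : bidual E :=
  blin_of (@ulim_factor_linear b) (ulim_factor_bound b).

Lemma ulim_factor_blin_linear : linear ulim_factor_blin.
Proof.
move=> a b b'; apply: blinP => phi; rewrite blin_addE blin_scaleE.
apply: cvg_lim => //.
rewrite (_ : (fun p => _) = fun p : cofinal_index =>
  a * factor p.2 phi (b p) + factor p.2 phi (b' p)).
  by apply: cvgD; [apply: cvgM; [exact: cvg_cst|]|]; exact: ulim_factorP.
by apply/funext => p; exact: blin_linear.
Qed.

Definition to_bidual (z : ultraproduct U Q) : bidual E :=
  ulim_factor_blin (srepr z).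

(** Independence of the representative: two representatives differ by a family of limit norm 0,
    which bounds the difference of the images. *)
Lemma to_bidual_uclass b : to_bidual (uclass U b) = ulim_factor_blin b.
Proof.
apply/eqP; rewrite -subr_eq0 -normr_le0.
have <- : ulim_norm U (srepr (uclass U b) - b) = 0.
  exact: (@spiK _ _ (ulim_seminorm U Q)).
have -> : to_bidual (uclass U b) - ulim_factor_blin b =
    ulim_factor_blin (srepr (uclass U b) - b).
  have := ulim_factor_blin_linear (-1) b (srepr (uclass U b)).
  by rewrite !scaleN1r addrC => <-; rewrite addrC.
exact: blin_of_norm.
Qed.

Lemma to_bidual_linear : linear to_bidual.
Proof.
move=> a y z; rewrite -[y]sreprK -[z]sreprK -spiZ -spiD.
by rewrite !to_bidual_uclass ulim_factor_blin_linear.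
Qed.

Lemma to_bidual_bound : op_bound to_bidual 1.
Proof.
split=> // z; rewrite mul1r -[z in leRHS]sreprK norm_spi.
exact: blin_of_norm.
Qed.

Lemma bidual_factorization (I : lip_class R) (f : X -> E) :
  banach_lip_ideal I -> lc_mem (max_hull I) f -> 
  @canon_incl R E \o f = to_bidual \o
    @ultramap R _ U _ _ (fun p : cofinal_index =>
      quotient_map p.2 \o f \o @incl R X p.1) \o embed.
Proof.
move=> HI Mf; have Iq p := max_hull_quotient HI p.1 p.2 Mf.
apply/funext => x /=.
rewrite (@ultramapE _ _ U _ _ _ (lc_norm (max_hull I) f)) => [p|p|]; last 1 first.
- move=> f0 fc; rewrite to_bidual_uclass; apply: blinP => phi.
  (* Where [x] lies in the finite subset and [phi] vanishes on the subspace, the term is exactly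
     [phi (f x)]. *)
  apply/esym/ultra_lim_eq; apply: filterS (filterI (UX x) (UE phi)) => p.
  move=> [px pphi]; rewrite /= -[_ (quotient_map _ _)]/(factor _ _ _).
  by rewrite factorE//= retractE.
- exact: (bli_Lip0 HI (Iq p).1).1.
- have [k0 fk] := ideal_lip_bound HI (Iq p).1.
  split=> [|y z]; first exact: le_trans k0 (Iq p).2.
  by rewrite (le_trans (fk y z))// ler_wpM2r ?mdist_ge0//; case: (Iq p).
Qed.

End max_hull_of_ultrastable.

Lemma regular_ultrastable_maximal (R : realType) (I : lip_class R) :
  banach_lip_ideal I -> regular I -> ultrastable I -> maximal I.
Proof.
move=> HI /(regularP HI) Ireg Iultra; apply/(maximalP HI) => X E f Mf.
have [U [UX UE]] := cofinal_ultrafilter X E.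
have Iq (p : cofinal_index X E) := max_hull_quotient HI p.1 p.2 Mf.
pose g (p : cofinal_index X E) := quotient_map p.2 \o f \o @incl R X p.1.
have gc : exists c, forall p, lc_norm I (g p) <= c.
  by exists (lc_norm (max_hull I) f) => p; case: (Iq p).
have [IF Fc] := Iultra _ U _ _ g (fun p => (Iq p).1) gc.
have Fle := le_trans Fc (@ultra_lim_bound _ _ U _ (lc_norm (max_hull I) f)
  (lc_norm (max_hull I) f) _ _).
have [] := @ideal_comp _ _ HI _ _ _ _ (embed U) _
  (blin_of (to_bidual_linear UE) (to_bidual_bound UE)) 1 1
  (embed_base UX) (embed_lip_bound UX) (blin_of_norm _ _) IF.
rewrite mul1r mulr1 -(bidual_factorization UX UE HI Mf) => IJ JF.
have [If fJ] := Ireg _ _ _ Mf.1 IJ; split=> //.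
apply: le_trans fJ (le_trans JF (Fle _ _)) => [p|].
  by rewrite ger0_norm ?(ideal_norm_ge0 HI)//; case: (Iq p).
by apply: nearW => p; case: (Iq p).
Qed.

(** * Local duality of ultraproducts *)

Section approximating_operator.
Variables (R : realType) (E M : completeNormedModType R).
Variables (m n : nat) (Lam : finType).
Variables (e : 'I_m -> M) (nu : Lam -> dual M) (K eps : R).
Variables (y : 'I_n -> E) (a : 'I_m -> 'I_n -> R).
Hypothesis K0 : 0 <= K.
Hypothesis eps0 : 0 < eps.

(** Functionals on the [m]-th power of [E] give operators to [M] through their components and [e].
    Here [w l] tests the bound on [nu l \o S], and [c j k] tests the [j]-th component at [y k];
    [tensor_cost] adds up the required bounds. *)
Definition tensor_sum (w : Lam -> E) (c : 'I_m -> 'I_n -> R) (j : 'I_m) : E :=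
  \sum_l nu l (e j) *: w l + \sum_k c j k *: y k.

Definition tensor_cost (w : Lam -> E) (c : 'I_m -> 'I_n -> R) : R :=
  \sum_l `|w l| + \sum_j \sum_k (c j k * a j k + eps * `|c j k|).

Hypothesis cost_ge0 :
  forall w c, 0 <= K * \sum_j `|tensor_sum w c j| + tensor_cost w c.

Let V := {ffun 'I_m -> E}.

Let G (v : V) (r : R) : Prop := exists w c,
  (forall j, v j = tensor_sum w c j) /\ tensor_cost w c <= r.

Let Gcone : convex_cone G.
Proof.
split=> [|v r v' r' [w [c [vE cr]]] [w' [c' [v'E cr']]]|t v r t0 [w [c [vE cr]]]].
- exists (fun=> 0), (fun _ _ => 0); split=> [j|].
    rewrite ffunE /tensor_sum !big1 ?addr0// => i _; first by rewrite scale0r.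
    by rewrite scaler0.
  rewrite /tensor_cost !big1 ?addr0// => [j _|l _]; last by rewrite normr0.
  by rewrite big1// => k _; rewrite normr0 mulr0 mul0r addr0.
- exists (fun l => w l + w' l), (fun j k => c j k + c' j k); split=> [j|].
    rewrite ffunE vE v'E /tensor_sum addrACA -!big_split; congr (_ + _).
      by apply: eq_bigr => l _; rewrite scalerDr.
    by apply: eq_bigr => k _; rewrite scalerDl.
  apply: le_trans (lerD cr cr'); rewrite /tensor_cost addrACA -!big_split/=.
  rewrite lerD//; first by apply: ler_sum => l _; exact: ler_normD.
  apply: ler_sum => j _; rewrite -big_split; apply: ler_sum => k _ /=.
  rewrite mulrDl addrACA lerD2l -mulrDr ler_wpM2l ?(ltW eps0)//.
  exact: ler_normD.
- exists (fun l => t *: w l), (fun j k => t * c j k); split=> [j|].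
    rewrite ffunE vE /tensor_sum scalerDr !scaler_sumr; congr (_ + _).
      by apply: eq_bigr => l _; rewrite !scalerA mulrC.
    by apply: eq_bigr => k _; rewrite scalerA.
  apply: le_trans (ler_wpM2l (ltW t0) cr); rewrite /tensor_cost mulrDr.
  rewrite !mulr_sumr lerD//.
    by apply: ler_sum => l _; rewrite normrZ gtr0_norm.
  apply: ler_sum => j _; rewrite mulr_sumr; apply: ler_sum => k _.
  by rewrite normrM gtr0_norm// mulrDr !mulrA (mulrC eps t).
Qed.

Let p (v : V) : R := K * \sum_j `|v j|.

Let psub : sublinear p.
Proof.
split=> [v w|t v t0]; rewrite /p.
  rewrite -mulrDr ler_wpM2l// -big_split; apply: ler_sum => j _.
  by rewrite ffunE ler_normD.
rewrite mulrCA; congr (_ * _); rewrite mulr_sumr; apply: eq_bigr => j _.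
by rewrite ffunE normrZ ger0_norm.
Qed.

Let Gp v r : G v r -> 0 <= p (- v) + r.
Proof.
move=> [w [c [vE cr]]]; apply: le_trans (cost_ge0 w c) _; rewrite lerD//.
rewrite ler_wpM2l//; apply: ler_sum => j _.
by rewrite ffunE normrN vE.
Qed.

Let single j (x : E) : V := [ffun i => if i == j then x else 0].

(** [hahn_banach_cone] with [cost_ge0] as compatibility; the components of the functional are the
    coefficients of [S]. *)
Lemma approximating_operator : exists S : blin E M,
  (forall l x, `|nu l (S x)| <= `|x|) /\
  forall k, `|S (y k) - \sum_j a j k *: e j| <= eps * \sum_j `|e j|.
Proof.
have [f [fl fp fG]] := hahn_banach_cone psub Gcone Gp.
have sl j : linear (fun x => f (single j x)).
  move=> t x x'; rewrite -fl; congr f; apply/ffunP => i; rewrite !ffunE.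
  by case: ifP => //; rewrite scaler0 addr0.
have fN j x : f (single j (- x)) = - f (single j x).
  have f0 : f (single j 0) = 0.
    by have := sl j 1 0 0; rewrite scaler0 addr0 scale1r; lra.
  by have := sl j (-1) x 0; rewrite /= f0 scaleN1r !addr0 scaleN1r.
(* Domination by [p] makes the components bounded, hence [S0] continuous. *)
have fK j x : `|f (single j x)| <= K * `|x|.
  have h z : f (single j z) <= K * `|z|.
    rewrite (le_trans (fp _))// /p (bigD1 j)//= ffunE eqxx big1 ?addr0//.
    by move=> i /negPf ij; rewrite ffunE ij normr0.
  by rewrite ler_norml h andbT; have := h (- x); rewrite fN normrN; lra.
pose S0 x := \sum_j f (single j x) *: e j.
have Sl : linear S0.
  move=> t x x'; rewrite /S0 scaler_sumr -big_split; apply: eq_bigr => j _.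
  by rewrite sl scalerDl scalerA.
have Sb : op_bound S0 (K * \sum_j `|e j|).
  split=> [|x]; first by rewrite mulr_ge0// sumr_ge0.
  rewrite mulr_sumr mulr_suml (le_trans (ler_norm_sum _ _ _))//.
  by apply: ler_sum => j _; rewrite normrZ mulrAC ler_wpM2r.
exists (blin_of Sl Sb); split=> [l x|k].
  have h z : nu l (S0 z) <= `|z|.
    pose v : V := [ffun j => nu l (e j) *: z].
    have -> : nu l (S0 z) = f v.
      have vE : v = \sum_j nu l (e j) *: single j z.
        apply/ffunP => i; rewrite sum_ffunE (bigD1 i)//= big1 ?addr0.
          by rewrite !ffunE eqxx.
        by move=> j /negPf ji; rewrite !ffunE eq_sym ji scaler0.
      pose g : {linear V -> R^o} :=
        HB.pack f (GRing.isLinear.Build _ _ _ _ _ fl).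
      rewrite -[f v]/(g v) vE [RHS]linear_sum /S0 blin_sum; apply: eq_bigr => j _.
      by rewrite blinZ [RHS]linearZ; exact: mulrC.
    apply: fG; exists (fun l' => if l' == l then z else 0), (fun _ _ => 0).
    split=> [j|].
      rewrite ffunE /tensor_sum (bigD1 l)//= eqxx !big1 ?addr0// => [k _|i].
        by rewrite scale0r.
      by move=> /negPf ->; rewrite scaler0.
    rewrite /tensor_cost (bigD1 l)//= eqxx !big1 ?addr0// => [j _|i].
      by rewrite big1// => k _; rewrite normr0 mulr0 mul0r addr0.
    by move=> /negPf ->; rewrite normr0.
  rewrite ler_norml h andbT; have := h (- x).
  by rewrite -[S0 (- x)]/(blin_of Sl Sb (- x)) linearN linearN normrN; lra.
(* The values 1 and -1 of [s] bound the component at [y k] on both sides of [a j k]. *)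
have h j (s : R) : f (single j (s *: y k)) <= s * a j k + eps * `|s|.
  apply: fG; exists (fun=> 0),
    (fun j' k' => if (j' == j) && (k' == k) then s else 0); split=> [i|].
    rewrite ffunE /tensor_sum big1 ?add0r => [|l _]; last by rewrite scaler0.
    rewrite (bigD1 k)//= eqxx andbT big1 ?addr0 => [|k' /negPf ->].
      by case: ifP => //; rewrite scale0r.
    by rewrite andbF scale0r.
  rewrite /tensor_cost big1 ?add0r => [|l _]; last by rewrite normr0.
  rewrite (bigD1 j)//= (bigD1 k)//= !eqxx/= !big1 ?addr0//.
    move=> i /negPf ->; rewrite big1// => k' _.
    by rewrite normr0 mulr0 mul0r addr0.
  by move=> i /negPf ->; rewrite normr0 mulr0 mul0r addr0.
rewrite -[blin_of _ _ _]/(S0 (y k)) /S0 -sumrB mulr_sumr.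
rewrite (le_trans (ler_norm_sum _ _ _))//; apply: ler_sum => j _.
rewrite -scalerBl normrZ ler_wpM2r// ler_norml.
have := h j 1; have := h j (-1).
rewrite normrN1 normr1 scale1r scaleN1r fN; lra.
Qed.

End approximating_operator.

Section ultraproduct_classes.
Variables (R : realType) (T : Type) (U : ultrafilter T).
Variable E : T -> completeNormedModType R.
Implicit Types (b : bfam E).

Lemma uclass_linear : linear (@uclass R T U E).
Proof. exact: spi_linear. Qed.

HB.instance Definition _ := GRing.isLinear.Build R (bfam E) (ultraproduct U E)
  *:%R (@uclass R T U E) uclass_linear.

Lemma uclass_normP b : `|b i| @[i --> uf_set U] --> `|uclass U b|.
Proof. rewrite norm_uclass; exact: ulim_normP. Qed.

Lemma bfam_big_sumE (J : Type) (r : seq J) (P : pred J) (b : J -> bfam E) i :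
  (\sum_(j <- r | P j) b j) i = \sum_(j <- r | P j) b j i.
Proof.
elim: r => [|j r IH]; first by rewrite !big_nil.
by rewrite !big_cons; case: ifP => // _; rewrite -IH.
Qed.

Section multiplier.
Variables (c : T -> R) (C : R) (b : bfam E).
Hypothesis cC : forall i, `|c i| <= C.

Let mul_bounded : exists M, forall i, `|c i *: b i| <= M.
Proof.
have [M bM] := bf_bounded b; exists (C * M) => i.
rewrite normrZ; apply: ler_pM => //; exact: bM.
Qed.

Definition bfam_mul : bfam E := BFam mul_bounded.

Lemma uclass_mul : uclass U bfam_mul = lim (c @ uf_set U) *: uclass U b.
Proof.
rewrite -linearZ; apply/uclassP; apply: cvg_lim => //.
rewrite (_ : (fun i => _) = fun i => `|c i - lim (c @ uf_set U)| * `|b i|).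
  rewrite -(mul0r `|uclass U b|) -[in X in X * _](normr0 R).
  apply: cvgM; last exact: uclass_normP.
  apply: cvg_norm; rewrite -(subrr (lim (c @ uf_set U))).
  by apply: cvgB; [exact: ultra_cvg cC|exact: cvg_cst].
by apply/funext => i /=; rewrite -scalerBl normrZ.
Qed.

End multiplier.

End ultraproduct_classes.

Section ultraproduct_duality.
Variables (R : realType) (T : Type) (U : ultrafilter T).
Variable E : T -> completeNormedModType R.
Variables (M : completeNormedModType R) (q : blin (ultraproduct U E) M).
Variables (m n : nat) (Lam : finType).
Variables (e : 'I_m -> M) (phi : 'I_m -> dual M) (nu : Lam -> dual M).
Variables (K eps : R) (y : 'I_n -> bfam E).
Hypothesis frame : forall x, x = \sum_j phi j x *: e j.
Hypothesis nu1 : forall l, `|nu l| <= 1.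
Hypothesis q1 : `|q| <= 1.
Hypothesis K0 : 0 <= K.
Hypothesis phiK : forall j, `|phi j| <= K.
Hypothesis eps0 : 0 < eps.

Let a j k : R := phi j (q (uclass U (y k))).
Let A : R := \sum_j \sum_k `|a j k|.

Let value i (w : Lam -> E i) c : R :=
  K * \sum_j `|tensor_sum e nu (fun k => y k i) w c j| +
  tensor_cost eps a w c.

Let bad i := exists w c, value (i := i) w c < 0.

(** The value is positively homogeneous, so a violation can be scaled until the coefficients [c]
    have total absolute value 1. The bounds on [w] and [c] are then independent of [i], and the gap
    [eps] is fixed. *)
Let normalized i : bad i -> exists (w : Lam -> E i) c,
  [/\ forall l, `|w l| <= A, forall j k, `|c j k| <= 1 &
  K * \sum_j `|tensor_sum e nu (fun k => y k i) w c j| + \sum_l `|w l| +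
    \sum_j \sum_k c j k * a j k + eps <= 0].
Proof.
move=> [w [c]]; rewrite /value /tensor_cost => wc.
pose s := \sum_j \sum_k `|c j k|.
have costE : \sum_j \sum_k (c j k * a j k + eps * `|c j k|) =
    \sum_j \sum_k c j k * a j k + eps * s.
  rewrite /s mulr_sumr -big_split; apply: eq_bigr => j _.
  by rewrite big_split/= mulr_sumr.
have cs j k : `|c j k| <= s.
  rewrite /s (bigD1 j)//= (bigD1 k)//= -addrA lerDl addr_ge0// sumr_ge0// => j' _.
  exact: sumr_ge0.
have W0 : 0 <= \sum_l `|w l| by exact: sumr_ge0.
have V0 : 0 <= K * \sum_j `|tensor_sum e nu (fun k => y k i) w c j|.
  by rewrite mulr_ge0// sumr_ge0.
have s0 : 0 <= s by apply: sumr_ge0 => j _; exact: sumr_ge0.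
(* If [s] were 0, then [c] would vanish and the value would be nonnegative. *)
have {}s0 : 0 < s.
  rewrite lt_def s0 andbT; apply/eqP => sE; move: wc; apply/negP.
  rewrite -leNgt costE sE mulr0 addr0 !addr_ge0// big1// => j _.
  rewrite big1// => k _.
  have -> : c j k = 0 by apply/eqP; rewrite -normr_le0 -sE.
  by rewrite mul0r.
have si0 : 0 < s^-1 by rewrite invr_gt0.
pose w' l := s^-1 *: w l; pose c' j k := s^-1 * c j k.
have main : K * \sum_j `|tensor_sum e nu (fun k => y k i) w' c' j| +
    \sum_l `|w' l| + \sum_j \sum_k c' j k * a j k + eps <= 0.
  have tE j : tensor_sum e nu (fun k => y k i) w' c' j =
      s^-1 *: tensor_sum e nu (fun k => y k i) w c j.
    rewrite /tensor_sum scalerDr !scaler_sumr; congr (_ + _).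
      by apply: eq_bigr => l _; rewrite /w' !scalerA mulrC.
    by apply: eq_bigr => k _; rewrite scalerA.
  have -> : \sum_j `|tensor_sum e nu (fun k => y k i) w' c' j| =
      s^-1 * \sum_j `|tensor_sum e nu (fun k => y k i) w c j|.
    by rewrite mulr_sumr; apply: eq_bigr => j _; rewrite tE normrZ gtr0_norm.
  have -> : \sum_l `|w' l| = s^-1 * \sum_l `|w l|.
    by rewrite mulr_sumr; apply: eq_bigr => l _; rewrite normrZ gtr0_norm.
  have -> : \sum_j \sum_k c' j k * a j k = s^-1 * \sum_j \sum_k c j k * a j k.
    rewrite mulr_sumr; apply: eq_bigr => j _; rewrite mulr_sumr.
    by apply: eq_bigr => k _; rewrite mulrA.
  rewrite mulrCA -!mulrDr -[X in _ + X](mulKf (lt0r_neq0 s0)) -mulrDr.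
  rewrite pmulr_rle0// (mulrC s); move: wc; rewrite costE; lra.
have c1 j k : `|c' j k| <= 1.
  by rewrite normrM gtr0_norm// mulrC ler_pdivrMr// mul1r.
have aux (k W C x b : R) :
    0 <= k -> - b <= C -> x <= W -> k + W + C + eps <= 0 -> x <= b.
  by move: eps0; lra.
exists w', c'; split=> // l; apply: aux main.
- by rewrite mulr_ge0// sumr_ge0.
- rewrite /A -sumrN; apply: ler_sum => j _; rewrite -sumrN.
  apply: ler_sum => k _.
  have : `|c' j k * a j k| <= `|a j k| by rewrite normrM ler_piMl.
  by rewrite ler_norml => /andP[].
- by rewrite [leRHS](bigD1 l)//= lerDl sumr_ge0.
Qed.

(** Otherwise normalized violations on a set of [U] would have a limit in the ultraproduct. There
    [q] itself takes the values [a] exactly and obeys the bounds, which leaves no room for the gap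
    [eps]. *)
Lemma ultraproduct_duality : uf_set U [set i | forall w c,
  0 <= K * \sum_j `|tensor_sum e nu (fun k => y k i) w c j| +
       tensor_cost eps a w c].
Proof.
have [//|Ubad] := in_ultra_setVsetC [set i | forall w c,
  0 <= K * \sum_j `|tensor_sum e nu (fun k => y k i) w c j| +
       tensor_cost eps a w c] (uf_ultra U).
exfalso.
have {}Ubad : uf_set U bad.
  apply: filterS Ubad => i /= /existsNP[w /existsNP[c /negP]].
  by rewrite -ltNge; exists w, c.
have A0 : 0 <= A by apply: sumr_ge0 => j _; exact: sumr_ge0.
have ex i : exists wc : (Lam -> E i) * ('I_m -> 'I_n -> R),
  [/\ forall l, `|wc.1 l| <= A, forall j k, `|wc.2 j k| <= 1 & bad i ->
  K * \sum_j `|tensor_sum e nu (fun k => y k i) wc.1 wc.2 j| + \sum_l `|wc.1 l| +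
    \sum_j \sum_k wc.2 j k * a j k + eps <= 0].
  have [/normalized[w [c [wA c1 wc]]]|nb] := pselect (bad i).
    by exists (w, c).
  (* Zero outside [bad] keeps the chosen families bounded at every index. *)
  by exists ((fun=> 0), (fun _ _ => 0)); split=> // *; rewrite normr0.
pose w i := (projT1 (cid (ex i))).1; pose c i := (projT1 (cid (ex i))).2.
have wA i l : `|w i l| <= A by rewrite /w; case: (cid (ex i)) => ? [].
have c1 i j k : `|c i j k| <= 1 by rewrite /c; case: (cid (ex i)) => ? [].
have wc i : bad i ->
    K * \sum_j `|tensor_sum e nu (fun k => y k i) (w i) (c i) j| +
    \sum_l `|w i l| + \sum_j \sum_k c i j k * a j k + eps <= 0.
  by rewrite /w /c; case: (cid (ex i)) => ? [].
have wb l : exists B, forall i, `|w i l| <= B by exists A.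
pose W l : bfam E := BFam (wb l).
pose cy j k := bfam_mul (y k) (fun i => c1 i j k).
pose cl j k := lim ((fun i => c i j k) @ uf_set U).
have clP j k : (fun i => c i j k) @ uf_set U --> cl j k.
  exact: (ultra_cvg (M := 1) (fun i => c1 i j k)).
pose v j : bfam E := \sum_l nu l (e j) *: W l + \sum_k cy j k.
have vE j i : v j i = tensor_sum e nu (fun k => y k i) (w i) (c i) j.
  by rewrite /v /= !bfam_big_sumE.
have uv j : uclass U (v j) =
    \sum_l nu l (e j) *: uclass U (W l) + \sum_k cl j k *: uclass U (y k).
  rewrite /v linearD !linear_sum; congr (_ + _); apply: eq_bigr => l _.
    by rewrite linearZ.
  exact: uclass_mul.
have : K * \sum_j `|uclass U (v j)| + \sum_l `|uclass U (W l)| +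
    \sum_j \sum_k cl j k * a j k + eps <= 0.
  apply: (@ultra_cvg_le R T U (fun i => K * \sum_j `|v j i| + \sum_l `|W l i| +
    \sum_j \sum_k c i j k * a j k + eps) (fun=> 0)).
  - apply: cvgD; last exact: cvg_cst.
    apply: cvgD; last first.
      apply: cvg_big => [|j _]; first exact: add_continuous.
      apply: cvg_big => [|k _]; first exact: add_continuous.
      by apply: cvgM; [exact: clP|exact: cvg_cst].
    apply: cvgD.
      apply: cvgM; first exact: cvg_cst.
      apply: cvg_big => [|j _]; first exact: add_continuous.
      exact: uclass_normP.
    apply: cvg_big => [|j _]; first exact: add_continuous.
    exact: uclass_normP.
  - exact: cvg_cst.
  - apply: filterS Ubad => i /wc.
    suff -> : \sum_j `|tensor_sum e nu (fun k => y k i) (w i) (c i) j| =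
      \sum_j `|v j i| by [].
    by apply: eq_bigr => j _; rewrite vE.
(* By [frame], the terms with [W l] recombine to [nu l] at the image of [W l] under [q]. *)
have : \sum_j phi j (q (uclass U (v j))) =
    \sum_l nu l (q (uclass U (W l))) + \sum_j \sum_k cl j k * a j k.
  under eq_bigr do rewrite uv !blinD !blin_sum.
  rewrite big_split; congr (_ + _); last first.
    by apply: eq_bigr => j _; apply: eq_bigr => k _; rewrite !blinZ.
  rewrite exchange_big; apply: eq_bigr => l _.
  rewrite [q (uclass U (W l)) in RHS]frame blin_sum; apply: eq_bigr => j _.
  by rewrite !blinZ; exact: mulrC.
have : - (K * \sum_j `|uclass U (v j)|) <= \sum_j phi j (q (uclass U (v j))).
  rewrite mulr_sumr -sumrN; apply: ler_sum => j _.
  have : `|phi j (q (uclass U (v j)))| <= K * `|uclass U (v j)|.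
    rewrite (le_trans (blin_norm_le _ _))// ler_pM//.
    by rewrite (le_trans (blin_norm_le _ _))// ler_piMl.
  by rewrite ler_norml => /andP[].
have : \sum_l nu l (q (uclass U (W l))) <= \sum_l `|uclass U (W l)|.
  apply: ler_sum => l _; rewrite (le_trans (ler_norm _))//.
  rewrite (le_trans (blin_norm_le _ _))// (le_trans (ler_piMl _ (nu1 l)))//.
  by rewrite (le_trans (blin_norm_le _ _))// ler_piMl.
by move: eps0; lra.
Qed.

End ultraproduct_duality.

(** The norming family costs the factor [1 + d]; [eps] is divided beforehand to absorb the norms of
    the frame vectors. *)
Lemma local_operator (R : realType) (T : Type) (U : ultrafilter T)
    (E : T -> completeNormedModType R)
    (L : finCodimSubspace (ultraproduct U E)) n (y : 'I_n -> bfam E) d eps :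
  0 < d -> 0 < eps -> uf_set U [set i | exists S : blin (E i) (quotient_space L),
    `|S| <= 1 + d /\
    forall k, `|S (y k i) - quotient_map L (uclass U (y k))| <= eps].
Proof.
move=> d0 eps0; have [m [e [phi frame]]] := quotient_frame L.
have [Lam [nu [nu1 nuP]]] := norming_family frame d0.
pose K := \sum_j `|phi j|.
have K0 : 0 <= K by exact: sumr_ge0.
have phiK j : `|phi j| <= K.
  by rewrite /K (bigD1 j)//= lerDl; exact: sumr_ge0.
have e0 : 0 <= \sum_j `|e j| by exact: sumr_ge0.
have e1 : 0 < \sum_j `|e j| + 1 by rewrite ltr_wpDl.
have eps'0 : 0 < eps / (\sum_j `|e j| + 1) by exact: divr_gt0.
have := ultraproduct_duality y frame nu1 (quotient_blin_norm L) K0 phiK eps'0.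
apply: filterS => i cost; have [S [Snu Sy]] := approximating_operator K0 eps'0 cost.
exists S; split=> [|k].
  apply: opnorm_blin_le => [|x]; first by rewrite addr_ge0// ltW.
  by apply: nuP => l; exact: Snu.
rewrite -quotient_blinE [quotient_blin L _]frame (le_trans (Sy k))//.
by rewrite mulrAC ler_pdivrMr// ler_wpM2l ?(ltW eps0)// lerDl.
Qed.

(** * Ultrastability of maximal ideals *)

Section finite_metric_spaces.
Variables (R : realType) (X : pmetricType R) (s : seq X).
Hypothesis sX : forall x, x \in s.

(** The sum of all difference quotients dominates each one; the diagonal terms are 0. *)
Lemma finite_lip_bound (Y : pmetricType R) (f : X -> Y) :
  exists k, lip_bound f k.
Proof.
have d0 x y : 0 <= mdist (f x) (f y) / mdist x y.
  by rewrite divr_ge0// mdist_ge0.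
exists (\sum_(x <- s) \sum_(y <- s) mdist (f x) (f y) / mdist x y).
split=> [|x y]; first by apply: sumr_ge0 => x _; exact: sumr_ge0.
have [->|xy] := eqVneq x y; first by rewrite !mdistxx mulr0.
rewrite -ler_pdivrMr ?mdist_gt0// (big_rem x)//= (big_rem y)//= -addrA lerDl.
by rewrite addr_ge0// sumr_ge0// => z _; exact: sumr_ge0.
Qed.

End finite_metric_spaces.

Lemma finPSubset_enum (R : realType) (X : pmetricType R) (X0 : finPSubset X) :
  exists2 s : seq (pmetric_sub X0), uniq s & forall x, x \in s.
Proof.
have /finite_seqP[t tE] := fps_finite X0.
exists (undup (pmap insub t)); first exact: undup_uniq.
move=> x; rewrite mem_undup mem_pmap_sub.
have tX0 y : fps_set X0 y -> y \in t by rewrite tE.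
exact: (tX0 _ (set_valP x)).
Qed.

Section finite_domain.
Variables (R : realType) (I : lip_class R).
Hypothesis HI : banach_lip_ideal I.
Variables (X : pmetricType R) (M : completeNormedModType R).

Lemma ideal_sum (J : Type) (r : seq J) (F : J -> X -> M) :
  (forall j, lc_mem I (F j)) -> lc_mem I (fun x => \sum_(j <- r) F j x) /\
  lc_norm I (fun x => \sum_(j <- r) F j x) <= \sum_(j <- r) lc_norm I (F j).
Proof.
move=> IF; elim: r => [|j r [Ir rle]].
  (* Written as a zero multiple, the empty sum has norm 0 by homogeneity. *)
  have -> : (fun x : X => \sum_(j <- [::]) F j x) = fun x => 0 *: (0 : M).
    by apply/funext => x; rewrite big_nil scaler0.
  rewrite big_nil (bli_normZ HI 0 (bli_0 HI X M)) normr0 mul0r; split=> //.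
  exact: (bli_Z HI 0 (bli_0 HI X M)).
have -> : (fun x => \sum_(i <- j :: r) F i x) =
    fun x => F j x + \sum_(i <- r) F i x.
  by apply/funext => x; rewrite big_cons.
split; first exact: (bli_D HI).
by rewrite big_cons (le_trans (bli_normD HI (IF j) Ir))// lerD2l.
Qed.

Variable s : seq X.
Hypothesis us : uniq s.
Hypothesis sX : forall x, x \in s.

(** The mass at the base point is the zero map, so that all of these maps preserve base points. *)
Definition point_mass (x z : X) : R^o :=
  if (z == x) && (x != pm_base X) then 1 else 0.

Lemma ideal_point_mass x : lc_mem I (point_mass x).
Proof.
have id_linear : linear (@id R^o) by [].
have id_bound : op_bound (@id R^o) 1 by split=> // t; rewrite mul1r.
apply: (@bli_comp _ _ HI (pmetric_of R^o) X R^o R^o (point_mass x) id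
  (blin_of id_linear id_bound)); last exact: bli_id.
split; last exact: (finite_lip_bound sX).
by rewrite /point_mass /= eq_sym; case: eqP.
Qed.

(** The map [h] is the sum of its values times point masses, so small values force a small ideal
    norm. *)
Lemma ideal_finite_domain (h : X -> M) : h (pm_base X) = 0 ->
  lc_mem I h /\ lc_norm I h <= \sum_(x <- s) `|h x| * lc_norm I (point_mass x).
Proof.
move=> h0; have mass x : lc_mem I (fun z => point_mass x z *: h x) /\
    lc_norm I (fun z => point_mass x z *: h x) <=
      `|h x| * lc_norm I (point_mass x).
  have hl : linear (fun t : R^o => t *: h x : M).
    by move=> a t u; rewrite scalerDl scalerA.
  have hb : op_bound (fun t : R^o => t *: h x : M) `|h x|.
    by split=> // t; rewrite normrZ mulrC.
  exact: (ideal_comp_blin HI (blin_of_norm hl hb) (ideal_point_mass x)).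
have hE : (fun z => \sum_(x <- s) point_mass x z *: h x) = h.
  apply/funext => z; rewrite (bigD1_seq z)//= big1 => [|x /negPf xz].
    rewrite addr0 /point_mass eqxx/=.
    by case: eqP => [->|_]; rewrite ?scale1r// h0 scaler0.
  by rewrite /point_mass eq_sym xz scale0r.
have [] := ideal_sum s (fun x => (mass x).1); rewrite hE => Ih hs; split=> //.
rewrite (le_trans hs)//; apply: ler_sum => x _; exact: (mass x).2.
Qed.

End finite_domain.

Section ultramap_lipschitz.
Variables (R : realType) (T : Type) (U : ultrafilter T).
Variables (X : T -> pmetricType R) (E : T -> completeNormedModType R).
Variables (f : forall i, X i -> E i) (C : R).
Hypothesis f0 : forall i, f (pm_base (X i)) = 0.
Hypothesis fC : forall i, @lip_bound R (X i) (pmetric_of (E i)) (@f i) C.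
Local Notation F := (@ultramap R T U X E f).

Lemma Lip0_ultramap : @Lip0 R (ultralimit U X) (pmetric_of (ultraproduct U E)) F.
Proof.
split.
  rewrite (ultramapE U f0 fC) -[RHS]/(0 : ultraproduct U E).
  rewrite -(linear0 (@uclass R T U E)).
  apply/uclassP; apply: ultra_lim_eq; apply: nearW => i /=.
  by rewrite f0 subr0 normr0.
(* An index is required to read off [0 <= C]; an ultrafilter provides one. *)
have [[i0]|] := pselect (exists i : T, True); last first.
  move=> nT; have := filter_ex (@filterT _ (uf_set U) _) => -[i].
  by case: nT; exists i.
move=> _; exists C; split; first by case: (fC i0).
move=> p r; rewrite mdist_pmetric_of -[p]preprK -[r]preprK.
rewrite !(ultramapE U f0 fC) -linearB [mdist _ _]mdist_pclass.
apply: (ultra_cvg_le (@uclass_normP _ _ U _ _)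
  (cvgM (cvg_cst C) (@ulim_distP _ _ U _ (prepr p) (prepr r)))).
by apply: nearW => i; exact: (fC i).2.
Qed.

End ultramap_lipschitz.

Lemma le_of_perturbation (R : realType) (x a : R) : 0 <= a ->
  (forall d, 0 < d -> x <= (1 + d) * (a + d) * (1 + d) + d) -> x <= a.
Proof.
move=> a0 h; apply/ler_addgt0Pr => e e0.
(* For [d <= 1] the expanded right-hand side is at most [a + d * (3 * a + 5)]. *)
pose d := Num.min 1 (e / (3 * a + 5)).
have c0 : 0 < 3 * a + 5 by lra.
have d0 : 0 < d by rewrite lt_min ltr01 divr_gt0.
have d1 : d <= 1 by rewrite ge_min lexx.
have de : d * (3 * a + 5) <= e.
  by rewrite -ler_pdivlMr// ge_min lexx orbT.
apply: le_trans (h _ d0) _.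
have dd : d * d <= d by rewrite ler_piMl// ltW.
have add : a * (d * d) <= a * d by rewrite ler_wpM2l.
have ddd : d * d * d <= d * d by rewrite ler_piMr// mulr_ge0// ltW.
nra.
Qed.

Lemma maximal_ultrastable (R : realType) (I : lip_class R) :
  banach_lip_ideal I -> maximal I -> ultrastable I.
Proof.
move=> HI /(maximalP HI) Imax T U X E f If [C fC].
have f0 i : f i (pm_base (X i)) = 0 by exact: (bli_Lip0 HI (If i)).1.
have fL i : @lip_bound R (X i) (pmetric_of (E i)) (f i) C.
  have [k0 fk] := ideal_lip_bound HI (If i).
  split=> [|x y]; first exact: le_trans k0 (fC i).
  by rewrite (le_trans (fk x y))// ler_wpM2r ?mdist_ge0.
have fn i : `|lc_norm I (f i)| <= C by rewrite ger0_norm// (ideal_norm_ge0 HI).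
pose F := @ultramap R T U X E f.
pose a := lim ((fun i => lc_norm I (f i)) @ uf_set U).
have a0 : 0 <= a.
  apply: (ultra_cvg_le (cvg_cst 0) (ultra_cvg fn)).
  by apply: nearW => i; exact: (ideal_norm_ge0 HI).
suff Fq (X0 : finPSubset (ultralimit U X))
    (L : finCodimSubspace (ultraproduct U E)) :
    lc_mem I (quotient_map L \o F \o @incl R _ X0) /\
    lc_norm I (quotient_map L \o F \o @incl R _ X0) <= a.
  have [MF Fa] := max_hull_mem HI (Lip0_ultramap U f0 fL) Fq.
  by have [IF FM] := Imax _ _ _ MF; split=> //; exact: le_trans FM Fa.
have [s us sX] := finPSubset_enum X0.
pose h := quotient_map L \o F \o @incl R _ X0.
have h0 : h (pm_base (pmetric_sub X0)) = 0.
  rewrite /h /= -/(F _) (_ : F _ = 0) ?[LHS](blin_0 (quotient_blin L))//.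
  exact: (Lip0_ultramap U f0 fL).1.
have [Ih _] := ideal_finite_domain HI us sX h0.
split=> //; apply: le_of_perturbation => // d d0.
pose D := \sum_(z <- s) lc_norm I (point_mass z).
have D0 : 0 <= D.
  by apply: sumr_ge0 => z _; apply: (ideal_norm_ge0 HI); exact: ideal_point_mass.
(* An error of at most [eps] at each point then has ideal norm at most [d]. *)
pose eps := d / (D + 1).
have eps0 : 0 < eps by rewrite divr_gt0// ltr_wpDl.
pose base : bpfam X := BPFam (bpbase_bounded X).
(* Representing the base point by [base] makes [g] below preserve base points exactly. *)
pose rep (z : pmetric_sub X0) : bpfam X :=
  if z == pm_base _ then base else prepr (incl z).
have repK z : pclass U (rep z) = incl z :> ultralimit U X.
  by rewrite /rep; case: eqP => [->//|_]; exact: preprK.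
pose zs (k : 'I_(size s)) := tnth (in_tuple s) k.
have zsP z : exists k, zs k = z.
  by have /tnthP[k ->] : z \in in_tuple s by []; exists k.
pose y k : bfam E := BFam (ultramap_bounded f0 fL (rep (zs k))).
have yE k : F (incl (zs k)) = uclass U (y k).
  by rewrite -repK /F (ultramapE U f0 fL).
have Ulip : uf_set U [set i | forall kl : 'I_(size s) * 'I_(size s),
    mdist (rep (zs kl.1) i) (rep (zs kl.2) i) <=
    (1 + d) * mdist (zs kl.1) (zs kl.2)].
  apply: filter_forall => -[k l] /=.
  have [->|kl] := eqVneq (zs k) (zs l).
    by apply: nearW => i; rewrite !mdistxx mulr0.
  have [B dB] := mdist_bounded (rep (zs k)) (rep (zs l)).
  apply: filterS (ultra_lim_lt dB (c := (1 + d) * mdist (zs k) (zs l)) _).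
    by move=> i /ltW.
  have -> : lim (mdist (rep (zs k) i) (rep (zs l) i) @[i --> uf_set U]) =
      mdist (zs k) (zs l).
    by rewrite mdist_set_type -[LHS](mdist_pclass U) !repK.
  (* For distinct points the limit distance is strictly below the bound, so the estimate holds on a
     set of [U]. *)
  by rewrite ltr_pMl ?mdist_gt0// ltrDl.
have Ua : uf_set U [set i | lc_norm I (f i) < a + d].
  by apply: (ultra_lim_lt fn); rewrite ltrDl.
have [i [[lipi ai] [S [S1 Sy]]]] :=
  filter_ex (filterI (filterI Ulip Ua) (local_operator L y d0 eps0)).
pose g (z : pmetric_sub X0) : X i := rep z i.
have g0 : g (pm_base (pmetric_sub X0)) = pm_base (X i).
  by rewrite /g /rep eqxx.
have gd : lip_bound g (1 + d).
  split=> [|z z']; first by rewrite addr_ge0// ltW.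
  have [k <-] := zsP z; have [l <-] := zsP z'; exact: (lipi (k, l)).
have [Ig gle] := ideal_comp HI g0 gd S1 (If i).
(* The map [h] is an ideal composite through [f i] plus this pointwise small correction. *)
pose r z := h z - (S \o f i \o g) z.
have r0 : r (pm_base (pmetric_sub X0)) = 0.
  by rewrite /r h0 /= g0 f0 blin_0 subr0.
have reps z : `|r z| <= eps.
  have [k <-] := zsP z; rewrite distrC /h /= -/(F _) yE; exact: Sy.
have [Ir rle] := ideal_finite_domain HI us sX r0.
have -> : quotient_map L \o F \o @incl R _ X0 =
    fun z => (S \o f i \o g) z + r z.
  by apply/funext => z; rewrite /r addrC subrK.
apply: le_trans (bli_normD HI Ig Ir) _; apply: lerD.
  have d1 : 0 <= 1 + d by rewrite addr_ge0// ltW.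
  by apply: le_trans gle _; rewrite !(ler_wpM2r, ler_wpM2l)// ltW.
apply: le_trans rle _.
apply: (@le_trans _ _ (\sum_(z <- s) eps * lc_norm I (point_mass z))).
  apply: ler_sum => z _; rewrite ler_wpM2r//.
  by apply: (ideal_norm_ge0 HI); exact: ideal_point_mass.
rewrite -mulr_sumr -/D /eps mulrAC ler_pdivrMr ?ltr_wpDl//.
by rewrite ler_wpM2l ?(ltW d0)// lerDl.
Qed.

Theorem theorem3p6 (R : realType) (I : lip_class R)
    (HI : banach_lip_ideal I) :
  maximal I <-> regular I /\ ultrastable I.
Proof.
split=> [Imax|[]]; last exact: regular_ultrastable_maximal.
by split; [exact: maximal_regular|exact: maximal_ultrastable].
Qed.
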